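(* Let $\gamma$ be a self-dual closed curve in $\mathbb{RP}^2$ (possibly with inflections and cusps), with associated circle diffeomorphism $\varphi$ and bilinear form $F$. Assume that $\gamma$ is not a multiple of another curve. Then $\varphi^2=\mathrm{id}$ if and only if $F$ is symmetric.
   Context: $V=\mathbb R^3$, $P=\mathbb{RP}^2$ is its projectivization, $P^*$ is the projectivization of $V^*$. A contact element of $P$ is a pair $(A,B)$ with $A\in P$ a point, $B\subset P$ a line, $A\in B$. The space of contact elements carries the contact structure given by the condition that the velocity of $A$ lies in $B$. A closed curve (wave front) $\gamma(t)\subset P$, $t\in S^1=\mathbb R/2\pi\mathbb Z$, is the projection $(A,B)\mapsto A$ of a smooth (immersed) closed Legendrian curve $\Gamma(t)$ in the space of contact elements; the line $B$ of $\Gamma(t)$ is the tangent line $T_{\gamma(t)}\gamma$. The dual curve $\gamma^*(t)\in P^*$ is the annihilator of $T_{\gamma(t)}\gamma$; thus away from the singular points the covector $\gamma^*(t)$ vanishes on $\gamma(t)$ and $\gamma'(t)$. The curve $\gamma$ is self-dual if there exist a projective isomorphism $\hat f\colon P\to P^*$ and a diffeomorphism $\varphi$ of $S^1$ with $\hat f(\gamma(\varphi(t)))=\gamma^*(t)$ for all $t$, where $\hat f$ takes the parameterized curve, as a front with its tangent lines, to the dual curve with its tangent lines. The isomorphism $\hat f$ is induced by a linear isomorphism $f\colon V\to V^*$ (defined up to a non-zero factor), and $F(v,w)=\langle f(v),w\rangle$ is the associated bilinear form on $V$. A curve is a multiple of another curve if it is, up to reparameterization, another closed curve traversed $k$ times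 for some $k>1$. *)

(* Defs.v *)
From HB Require Import structures.
From mathcomp Require Import all_boot all_order all_algebra generic_quotient.
From mathcomp Require Import all_classical all_reals all_analysis.

Set Implicit Arguments.
Unset Strict Implicit.
Unset Printing Implicit Defensive.

Import Order.TTheory GRing.Theory Num.Theory.
Import numFieldNormedType.Exports.

Local Open Scope ring_scope.
Local Open Scope quotient_scope.
Local Open Scope classical_set_scope.

Definition two_piZ (R : realType) : {pred R} :=
  [pred x : R | x / (2 * pi) \is a Num.int].
Arguments two_piZ : clear implicits.

Lemma two_piZ_zmod_closed (R : realType) : zmod_closed (two_piZ R).
Proof.
split=> [|x y]; rewrite !inE ?mul0r ?rpred0 // => hx hy.
by rewrite mulrBl rpredB.
Qed.

HB.instance Definition _ (R : realType) :=
  GRing.isZmodClosed.Build R (two_piZ R) (two_piZ_zmod_closed R).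

(* The additive group R / 2 pi Z; [\pi_(circle R) t] is the class of [t], and
   [s *+ k] is the image of [s] under the k-fold covering of the circle. *)
Notation circle R := (Quotient.quot (two_piZ R)).

Lemma circle_eqP (R : realType) (t u : R) :
  reflect (exists n : int, t = u + n%:~R * (2 * pi))
          (\pi_(circle R) t == \pi_(circle R) u).
Proof.
have p0 : 2 * pi != 0 :> R by rewrite mulf_neq0 ?pnatr_eq0 // gt_eqF ?pi_gt0.
rewrite -(Quotient.idealrBE (two_piZ R)).
have intP := @Num.Theory.intrP R ((t - u) / (2 * pi)); apply: (iffP intP).
  by case=> n e; exists n; rewrite -e divfK // addrC subrK.
by case=> n ->; exists n; rewrite addrAC subrr add0r mulfK.
Qed.

Lemma circle_piMn (R : realType) (t : R) (k : nat) :
  \pi_(circle R) t *+ k = \pi_(circle R) (t *+ k).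
Proof.
elim: k => [|k IH]; first by rewrite !mulr0n -[0 in RHS]/(0 : R) piE.
by rewrite !mulrS IH piE.
Qed.

Definition smooth_at (R : realType) (E : normedModType R) (u : R -> E) (t0 : R) :=
  \forall t \near t0, forall n : nat, derivable (derive1n n u) t 1.

Definition smooth_circle_map (R : realType) (phi : circle R -> circle R) :=
  forall t0 : R, exists2 u : R -> R, smooth_at u t0 &
    \forall t \near t0, phi (\pi_(circle R) t) = \pi_(circle R) (u t).

Definition circle_diffeo (R : realType) (phi : circle R -> circle R) :=
  smooth_circle_map phi /\
  exists psi : circle R -> circle R,
    [/\ smooth_circle_map psi, cancel phi psi & cancel psi phi].

(* Points and lines of a projective plane P(W) are the subspaces of W of
   dimension 1 and 2. *)
Record contact_element (K : fieldType) (W : vectType K) := ContactElement {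
  ce_point : {vspace W};
  ce_line : {vspace W};
  ce_axiom : [&& \dim ce_point == 1%N, \dim ce_line == 2%N &
                 (ce_point <= ce_line)%VS]
}.

Notation V3 R := 'rV[R]_3.
Notation dualV3 R := 'Hom('rV[R]_3, R^o).

Definition front (R : realType) := circle R -> contact_element (V3 R).

(* A smooth lift of [G] near [t0] along the submersion
   (a, b) |-> ([a], span(a, b)) onto the space of contact elements. *)
Definition local_frame (R : realType) (G : front R) (t0 : R) (a b : R -> V3 R) :=
  [/\ smooth_at a t0, smooth_at b t0 &
      \forall t \near t0,
        ce_point (G (\pi_(circle R) t)) = <[a t]>%VS /\
        ce_line (G (\pi_(circle R) t)) = <<[:: a t; b t]>>%VS].

(* With A = [a] and B = span(a, b), the velocity of A is a' mod A, an element
   of Hom(A, V/A); the velocity of B is induced by (a', b') mod B in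
   Hom(B, V/B).  Hence the Legendrian condition is a' \in B and, for a
   Legendrian curve, the velocity vanishes iff a' \in A and b' \in B.  Both
   conditions are independent of the choice of the frame. *)
Definition immersed_legendrian (R : realType) (G : front R) :=
  forall t0 : R, exists a b : R -> V3 R,
    [/\ local_frame G t0 a b,
        derive1 a t0 \in ce_line (G (\pi_(circle R) t0)) &
        ~ (derive1 a t0 \in ce_point (G (\pi_(circle R) t0)) /\
           derive1 b t0 \in ce_line (G (\pi_(circle R) t0)))].

Definition restrict_form (K : fieldType) (W : vectType K) (U : {vspace W})
    (xi : 'Hom(W, K^o)) : 'Hom(W, K^o) := (xi \o projv U)%VF.

Lemma restrict_form_is_linear (K : fieldType) (W : vectType K)
    (U : {vspace W}) : linear (restrict_form U).
Proof. by move=> k x y; rewrite /restrict_form comp_lfunDl comp_lfunZl. Qed.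

HB.instance Definition _ (K : fieldType) (W : vectType K) (U : {vspace W}) :=
  GRing.isLinear.Build _ _ _ _ (restrict_form U) (restrict_form_is_linear U).

Definition annihilator (K : fieldType) (W : vectType K) (U : {vspace W}) :
    {vspace 'Hom(W, K^o)} :=
  lker (linfun (restrict_form U)).

Lemma memv_annihilator (K : fieldType) (W : vectType K) (U : {vspace W})
    (xi : 'Hom(W, K^o)) :
  reflect (forall u, u \in U -> xi u = 0) (xi \in annihilator U).
Proof.
rewrite memv_ker lfunE /= /restrict_form; apply: (iffP eqP) => [h u uU | h].
  by move/lfunP/(_ u): h; rewrite comp_lfunE projv_id // lfunE.
by apply/lfunP => v; rewrite comp_lfunE lfunE /= h // memv_proj.
Qed.

(* The dual front at [s] is the contact element (annihilator B, annihilator A)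
   of P^*, where (A, B) = G s: its line is the pencil of lines through A.  The
   front [G], the linear isomorphism [f] and the diffeomorphism [phi] realize
   self-duality when [f] maps G (phi s) to the dual contact element at [s]. *)
Definition self_duality (R : realType) (G : front R) (phi : circle R -> circle R)
    (f : 'Hom(V3 R, dualV3 R)) :=
  [/\ circle_diffeo phi, bijective f &
      forall s : circle R,
        (f @: ce_point (G (phi s)))%VS = annihilator (ce_line (G s)) /\
        (f @: ce_line (G (phi s)))%VS = annihilator (ce_point (G s))].

Definition assoc_form (R : realType) (f : 'Hom(V3 R, dualV3 R))
    (v w : V3 R) : R := f v w.

(* Fronts are compared together with their tangent lines. *)
Definition is_multiple (R : realType) (G : front R) :=
  exists (k : nat) (G' : front R) (theta : circle R -> circle R),
    [/\ (1 < k)%N, immersed_legendrian G', circle_diffeo theta &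
        forall s, G s = G' (theta s *+ k)].

(* Main.v *)
From HB Require Import structures.
Require Import Defs.
From mathcomp Require Import all_boot all_order all_algebra generic_quotient.
From mathcomp Require Import all_classical all_reals all_analysis.
From mathcomp Require Import ring lra.

Set Implicit Arguments.
Unset Strict Implicit.
Unset Printing Implicit Defensive.

Import Order.TTheory GRing.Theory Num.Theory.
Import numFieldNormedType.Exports.

Local Open Scope ring_scope.
Local Open Scope quotient_scope.
Local Open Scope classical_set_scope.

(* The form F makes the dual of a point of the curve the line of its partner:
   B(s) is the kernel of F(A(phi s), .).  Comparing the self-duality at s and
   at phi s gives f A(phi^2 s) = ann B(phi s) and F(B(phi s), A(s)) = 0.

   If F is symmetric, then G o phi^2 = G.  Parameterize the circle by the arc
   length of the curve s |-> (A(s), A(phi s)), which is immersed because B(s)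
   is recovered from A(phi s).  In this parameter phi^2 preserves speed, so it
   is locally x |-> +-x + c, hence globally by connectedness; a reflection
   would force zero velocity at its fixed point, so phi^2 is the translation by
   a period c of G.  The periods form a discrete group, generated by 2 pi / k,
   and k = 1 since G is not a multiple; thus phi^2 = id.

   If phi^2 = id, then every A(s) is an eigenline of the cosquare
   K = M^T M^-1 of the Gram matrix M of F, and the eigenvalue is locally
   constant.  By connectedness there is an s at which both A and A o phi move.
   If K were not scalar, then near s the point A would stay in a fixed line of
   P, which would be B, so B (hence A o phi) would not move.  So M^T = r M, and taking
   determinants in dimension 3 gives r = 1. *)

(** * Smooth functions of one variable *)

(* A germ-level version of C^n, so that the closure properties go by induction
   on n; smooth_at requires in addition one neighbourhood for all n. *)
Fixpoint diffn (R : realType) (E : normedModType R) (n : nat) (u : R -> E)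
    (t : R) : Prop :=
  if n is n'.+1 then
    (\forall s \near t, derivable u s 1) /\ diffn n' u^`() t
  else True.

Section Diffn.
Context {R : realType}.

Lemma near_near (P : R -> Prop) (t : R) :
  (\forall s \near t, P s) -> \forall s \near t, \forall r \near s, P r.
Proof. by move=> h; apply/near_join. Qed.

Section Normed.
Context {E : normedModType R}.
Implicit Types (u v : R -> E) (t : R).

Lemma near_eq_derive1 u v t : (\forall s \near t, u s = v s) ->
  \forall s \near t, u^`() s = v^`() s.
Proof.
move=> uv0; have uv := near_near uv0; near=> s; rewrite !derive1E;
  apply: near_eq_derive.
by near: s.
Unshelve. all: by end_near. Qed.

Lemma near_derivable u v t : (\forall s \near t, u s = v s) ->
  (\forall s \near t, derivable u s 1) -> \forall s \near t, derivable v s 1.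
Proof.
move=> uv0 du; have uv := near_near uv0; near=> s.
apply: (@near_eq_derivable _ _ _ u).
  by near: s.
by near: s.
Unshelve. all: by end_near. Qed.

Lemma diffn_eq n u v t : (\forall s \near t, u s = v s) ->
  diffn n u t -> diffn n v t.
Proof.
elim: n u v => [//|n IH] u v uv [du dn]; split.
  exact: near_derivable uv du.
exact: IH (near_eq_derive1 uv) dn.
Qed.

Lemma diffn_derivable n u t : diffn n.+1 u t -> derivable u t 1.
Proof. by case=> /nbhs_singleton. Qed.

Lemma diffnW n u t : diffn n.+1 u t -> diffn n u t.
Proof. by elim: n u => [//|n IH] u [du dn]; split=> //; apply: IH. Qed.

Lemma diffnP u t : (forall n, diffn n u t) <->
  (forall n, \forall s \near t, derivable (derive1n n u) s 1).
Proof.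
split=> [du n | du n].
  have := du n.+1; elim: n u {du} => [|n IH] u; first by case.
  by rewrite derive1Sn => -[_ /IH].
elim: n u du => [//|n IH] u du; split; first exact: du 0.
by apply: IH => m; have := du m.+1; rewrite derive1Sn.
Qed.

(** The neighbourhood in [smooth_at] is common to all orders, so the germ conditions are asked at
    every point near [t0]; this is the form in which the closure properties below apply. *)
Lemma smooth_atP u t0 :
  smooth_at u t0 <-> \forall t \near t0, forall n, diffn n u t.
Proof.
split=> [su0 | su]; [have su := near_near su0|].
  near=> t; apply/diffnP => n; have : \forall s \near t, forall n : nat,
    derivable (derive1n n u) s 1 by near: t.
  by apply: filterS => s.
by apply: filterS su => t /diffnP su n; apply: nbhs_singleton (su n).
Unshelve. all: by end_near. Qed.

Lemma diffn_cst n (c : E) t : diffn n (fun=> c) t.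
Proof.
elim: n c => [//|n IH] c; split; first by near do exact: derivable_cst.
by have -> : (fun=> c)^`() = (fun=> 0 : E) by apply/funext => s;
  rewrite derive1_cst.
Unshelve. all: by end_near. Qed.

End Normed.

Implicit Types (u v : R -> R) (t : R).

Lemma derivable_continuous u t : derivable u t 1 -> {for t, continuous u}.
Proof. by move=> /derivable1_diffP /differentiable_continuous. Qed.

Lemma diffnD n u v t :
  diffn n u t -> diffn n v t -> diffn n (fun s => u s + v s) t.
Proof.
elim: n u v => [//|n IH] u v [du dun] [dv dvn]; split.
  by apply: filterS2 du dv => s; exact: derivableD.
apply: diffn_eq (IH _ _ dun dvn); apply: filterS2 du dv => s dus dvs.
by rewrite !derive1E (@deriveD _ _ _ u v).
Qed.

Lemma diffnM n u v t :
  diffn n u t -> diffn n v t -> diffn n (fun s => u s * v s) t.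
Proof.
elim: n u v => [//|n IH] u v duS dvS.
have [[du dun] [dv dvn]] := (duS, dvS); split.
  by apply: filterS2 du dv => s; exact: derivableM.
apply: diffn_eq (diffnD (IH _ _ (diffnW duS) dvn) (IH _ _ (diffnW dvS) dun)).
apply: filterS2 du dv => s dus dvs.
by rewrite !derive1E (@deriveM _ _ u v).
Qed.

Lemma diffn_comp n u v t :
  diffn n v t -> diffn n u (v t) -> diffn n (fun s => u (v s)) t.
Proof.
elim: n u v => [//|n IH] u v dvS duS.
have [[dv dvn] [du dun]] := (dvS, duS).
have cv : {for t, continuous v}.
  by apply: derivable_continuous; apply: nbhs_singleton dv.
have du' : \forall s \near t, derivable u (v s) 1.
  exact: (cv _ du).
split.
  apply: filterS2 dv du' => s /derivable1_diffP dvs /derivable1_diffP dus.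
  by apply/derivable1_diffP/(@differentiable_comp _ _ _ _ v u).
apply: diffn_eq (diffnM (IH _ _ (diffnW dvS) dun) dvn).
by apply: filterS2 dv du' => s dvs dus; rewrite -(@derive1_comp _ v u).
Qed.

Lemma diffn_id n t : diffn n (@id R) t.
Proof.
case: n => [//|n]; split; first by near do exact: derivable_id.
have -> : (@id R)^`() = fun=> 1 by apply/funext => s; rewrite derive1_id.
exact: diffn_cst.
Unshelve. all: by end_near. Qed.

Lemma diffn_sum (I : finType) n (u : I -> R -> R) t :
  (forall i, diffn n (u i) t) -> diffn n (fun s => \sum_i u i s) t.
Proof.
move=> du.
suff H (r : seq I) : diffn n (fun s => \sum_(i <- r) u i s) t by exact: H.
elim: r => [|i r IH].
  by under eq_fun do rewrite big_nil; exact: diffn_cst.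
by under eq_fun do rewrite big_cons; apply: diffnD.
Qed.

Lemma diffnV n u t : u t != 0 -> diffn n u t -> diffn n (fun s => (u s)^-1) t.
Proof.
move=> ut0; elim: n => [//|n IH] duS; have [du dun] := duS.
have cu : {for t, continuous u}.
  by apply: derivable_continuous; apply: nbhs_singleton du.
have u0 : \forall s \near t, u s != 0 by exact: (cvgr_neq0 _ cu).
split.
  by apply: filterS2 u0 du => s; exact: derivableV.
have IHn := IH (diffnW duS).
apply: diffn_eq (diffnM (diffnM (diffn_cst n (-1 : R) t) (diffnM IHn IHn)) dun).
apply: filterS2 u0 du => s us0 dus; rewrite !derive1E (@deriveV _ _ u)//.
by rewrite mulN1r -invfM -expr2.
Qed.

(** The derivative u' / (2 sqrt u) involves only sqrt u and u', so the induction hypothesis supplies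
    its smoothness one order below. *)
Lemma diffn_sqrt n u t : 0 < u t -> diffn n u t ->
  diffn n (fun s => Num.sqrt (u s)) t.
Proof.
move=> ut0; elim: n => [//|n IH] duS; have [du dun] := duS.
have cu : {for t, continuous u}.
  by apply: derivable_continuous; apply: nbhs_singleton du.
have u0 : \forall s \near t, 0 < u s by apply: (cvgr_gt _ cu).
have D : \forall s \near t,
    is_derive s (1 : R) (fun s =>
      Num.sqrt (u s)) ((2 * Num.sqrt (u s))^-1 * derive1 u s).
  apply: filterS2 u0 du => s us0 dus.
  apply: (@is_derive1_comp _ Num.sqrt u); first exact: is_derive1_sqrt.
  by rewrite derive1E; exact: derivableP.
split; first by apply: filterS D => s [].
have IHn := IH (diffnW duS).
apply: diffn_eq (diffnM (diffnV _ (diffnM (diffn_cst n (2 : R) t) IHn)) dun).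
  by apply: filterS D => s [_ <-]; rewrite derive1E.
by rewrite mulf_neq0 ?pnatr_eq0// gt_eqF// sqrtr_gt0.
Qed.

End Diffn.

(** Reduces lifts with values in V to scalar calculus; the finitely many coordinates share a
    neighbourhood. *)
Lemma diffn_row (R : realType) m n (a : R -> 'rV[R]_m) (t : R) :
  diffn n a t <-> forall j, diffn n (fun s => a s 0 j) t.
Proof.
have D (b : R -> 'rV[R]_m) j : (\forall s \near t, derivable b s 1) ->
    \forall s \near t, (fun s => b s 0 j)^`() s = b^`() s 0 j.
  by apply: filterS => s dbs; rewrite !derive1E derive_mx ?mxE.
have N (b : R -> 'rV[R]_m) : (\forall s \near t, derivable b s 1) <->
    forall j, \forall s \near t, derivable (fun s => b s 0 j) s 1.
  split=> [db j | db].
    by apply: filterS db => s /derivable_mxP; apply.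
  have {}db : \forall s \near t, forall j, derivable (fun r => b r 0 j) s 1.
    exact: (@filter_forall R 'I_m
      (fun j s => derivable (fun r => b r 0 j) s 1) (nbhs t) _ db).
  by apply: filterS db => s h; apply/derivable_mxP => i j; rewrite (ord1 i).
elim: n a => [//|n IH] a; split=> [[da dan] j | da].
  split; first by move: j; apply/N.
  move/IH: dan => /(_ j); apply: diffn_eq.
  by have := D _ j da; apply: filterS.
have da1 : \forall s \near t, derivable a s 1.
  by apply/N => j; have [] := da j.
split=> //; apply/IH => j; have [_] := da j; apply: diffn_eq; exact: D.
Qed.

(** * Connectedness of the line, antiderivatives, local uniqueness *)

Section RealFunctions.
Context {R : realType}.
Implicit Types (u v : R -> R) (x y t : R).

(** The set where [P] holds is open and closed in the connected line. This makes local conclusions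
    global. *)
Lemma near_clopen (P : R -> Prop) t0 :
  (forall t, P t -> \forall s \near t, P s) ->
  (forall t, ~ P t -> \forall s \near t, ~ P s) ->
  P t0 -> forall t, P t.
Proof.
move=> oP oNP Pt0.
have cT : connected [set: R] by apply/connected_intervalP.
have op : open [set t | P t].
  by rewrite openE => t Pt; rewrite /interior; exact: oP.
have on : open (~` [set t | P t]).
  by rewrite openE => t Pt; rewrite /interior; exact: oNP.
have E : [set t | P t] = [set: R].
  apply: cT; first by exists t0.
  - by exists [set t | P t] => //; rewrite setTI.
  - exists [set t | P t]; rewrite ?setTI//.
    by rewrite -[X in closed X]setCK; exact: open_closedC.
by move=> t; have : [set: R] t by []; rewrite -E.
Qed.

Lemma is_derive0_itv_cst u (a b : R) :
  (forall x, a < x < b -> is_derive x (1 : R) u 0) ->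
  forall x y, a < x < b -> a < y < b -> u x = u y.
Proof.
move=> du.
have H x y : x <= y -> a < x < b -> a < y < b -> u x = u y.
  move=> xy /andP[ax xb] /andP[ay yb].
  have I z : z \in `[x, y]%R -> a < z < b.
    rewrite in_itv /= => /andP[xz zy].
    by rewrite (lt_le_trans ax xz) (le_lt_trans zy yb).
  have [z zI||c _] := @MVT_segment _ u (fun=> 0) x y xy.
  - by apply: du; apply: I; apply: subset_itv_oo_cc.
  - apply: derivable_within_continuous => z zI.
    by have [] := du _ (I _ zI).
  - by rewrite mul0r => /eqP; rewrite subr_eq0 => /eqP ->.
move=> x y xI yI; have [xy|/ltW yx] := leP x y; first exact: H.
by symmetry; apply: H.
Qed.

Lemma near_derive0_cst u t :
  (\forall s \near t, is_derive s (1 : R) u 0) -> \forall s \near t, u s = u t.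
Proof.
move=> /nbhs_ballP[e /= e0 he].
apply/nbhs_ballP; exists e => //= s se.
have I x : (t - e < x < t + e) = (`|t - x| < e).
  by rewrite ltr_distl; apply/idP/idP => /andP[? ?]; apply/andP; split; lra.
apply: (@is_derive0_itv_cst u (t - e) (t + e)).
- by move=> x; rewrite I => /he.
- by rewrite I.
- by rewrite I subrr normr0.
Qed.

Lemma derive0_cst u : (forall t, is_derive t (1 :
  R) u 0) -> forall t, u t = u 0.
Proof. by move=> du t; apply: is_derive_0_is_cst. Qed.

Lemma local_antiderivative u (b : R) : continuous u -> 0 < b ->
  exists F : R -> R, F 0 = 0 /\
    forall x, - b < x < b -> is_derive x (1 : R) F (u x).
Proof.
move=> cu b0.
pose F x := (\int[lebesgue_measure]_(t in [set` `[- b, x]]) (u t))%R.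
have dF x : - b < x < b -> is_derive x (1 : R) F (u x).
  move=> /andP[bx xb].
  have ui : (@lebesgue_measure R).-integrable `[- b, b] (EFin \o u).
    apply: continuous_compact_integrable; first exact: segment_compact.
    exact: continuous_subspaceT.
  have [dF F'] := continuous_FTC1_closed xb ui bx (cu x).
  by rewrite -F' derive1E; exact: derivableP.
exists (fun x => F x - F 0); rewrite subrr; split=> // x xb.
by apply: is_derive_eq; [apply: is_deriveB; exact: dF|rewrite subr0].
Qed.

(* Integrals with a fixed left end point only give antiderivatives on half-lines;
   those normalized at 0 on the intervals ]-n, n[ are glued together. *)
Lemma antiderivative u : continuous u ->
  exists F : R -> R, forall x, is_derive x (1 : R) F (u x).
Proof.
move=> cu.
have [F HF] : {F : nat -> R -> R & forall n, F n 0 = 0 /\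
    forall x, - n.+1%:R < x < n.+1%:R -> is_derive x (1 : R) (F n) (u x)}.
  apply: (@choice _ _ (fun n F => F 0 = 0 /\
    forall x, - n.+1%:R < x < n.+1%:R -> is_derive x (1 : R) F (u x))) => n.
  by apply: local_antiderivative.
have same m n x : - m.+1%:R < x < m.+1%:R -> - n.+1%:R < x < n.+1%:R ->
    F m x = F n x.
  wlog mn : m n / (m <= n)%N => [H xm xn | xm xn].
    by have [mn|/ltnW nm] := leqP m n; [exact: H|symmetry; exact: H].
  have [Fm0 dFm] := HF m; have [Fn0 dFn] := HF n.
  apply/eqP; rewrite -subr_eq0; apply/eqP.
  have -> : 0 = F m 0 - F n 0 by rewrite Fm0 Fn0 subrr.
  apply: (@is_derive0_itv_cst (fun x => F m x - F n x) (- m.+1%:R) m.+1%:R) =>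
    //.
    move=> y ym; have yn : - n.+1%:R < y < n.+1%:R.
      have : (m.+1%:R : R) <= n.+1%:R by rewrite ler_nat.
      by move: ym => /andP[? ?] ?; apply/andP; split; lra.
    apply: is_derive_eq; last exact: (subrr (u y)).
    by apply: is_deriveB; [exact: dFm|exact: dFn].
  by apply/andP; rewrite oppr_lt0 ltr0n.
(* Each x lies inside the interval of index [N x]; points close to x lie there too, so near x the
   glued function is the single [F (N x)]. *)
pose N x := Num.bound `|x|.
have NP x : - (N x).+1%:R < x < (N x).+1%:R.
  rewrite -ltr_norml; apply: lt_trans (archi_boundP (normr_ge0 x)) _.
  by rewrite ltr_nat.
exists (fun x => F (N x) x) => x.
have [_ dF] := HF (N x).
apply: near_eq_is_derive (dF x (NP x)).
have : x \in `]- (N x).+1%:R, (N x).+1%:R[%R by rewrite in_itv/=; exact: NP.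
move=> /near_in_itvoo; apply: filterS => y; rewrite in_itv/= => yN.
exact: same.
Qed.

Lemma sumsq_gt0 (J : finType) (a : J -> R) :
  (exists i, a i != 0) -> 0 < \sum_i a i ^+ 2.
Proof.
move=> [i ai0]; rewrite (bigD1 i)//= ltr_pwDl// ?sumr_ge0// => [|j _].
  by rewrite lt_neqAle sqr_ge0 eq_sym sqrf_eq0 ai0.
exact: sqr_ge0.
Qed.

(** By Caratheodory, u y - u x = g y (y - x) with g continuous at x and g x = a, so g does not
    vanish near x. *)
Lemma local_uniq (u : R -> R) (a x : R) : is_derive x (1 : R) u a -> a != 0 ->
  \forall y \near x, u y = u x -> y = x.
Proof.
move=> /is_derive1_caratheodory[g [ge gc gx]] a0.
have gn : \forall y \near x, g y != 0 by apply: (cvgr_neq0 _ gc); rewrite gx.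
apply: filterS gn => y gy0 uyx; apply/eqP.
by have /eqP := ge y; rewrite uyx subrr eq_sym mulf_eq0 (negPf gy0)/= subr_eq0.
Qed.

Lemma near_comp (u : R -> R) (P : R -> Prop) (x : R) : {for x, continuous u} ->
  (\forall y \near u x, P y) -> \forall y \near x, P (u y).
Proof. by move=> cu; exact: cu. Qed.

Lemma is_derive_affine (a b x : R) :
  is_derive x (1 : R) (fun y => a * y + b) a.
Proof.
have h : is_derive x (1 : R) (fun y => a * y) a.
  split; first by apply: derivableM.
  by rewrite (@deriveM _ _ (fun=> a) id)// derive_cst derive_id scaler0 addr0
    [_ *: _]mulr1.
split; first by apply: derivableD; first by case: h.
rewrite (@deriveD _ _ _ (fun y => a * y) (fun=> b)) ?derive_cst ?addr0.
- by case: h.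
- by case: h.
- exact: derivable_cst.
Qed.

End RealFunctions.

(** * Arc length and rigidity of closed curves *)

Section ArcLength.
Context {R : realType}.
Implicit Types (u v : R -> R) (x y t : R).

Lemma diffnS n u v : (forall t, is_derive t (1 : R) u (v t)) ->
  (forall t, diffn n v t) -> forall t, diffn n.+1 u t.
Proof.
move=> du dv t; split.
  by apply: filterE => s; have [] := du s.
have -> : derive1 u = v by apply/funext => s; rewrite derive1E;
  apply: derive_val.
exact: dv.
Qed.

Lemma derive_pos_incr u v : (forall t, is_derive t (1 : R) u (v t)) ->
  (forall t, 0 < v t) -> forall x y, x < y -> u x < u y.
Proof.
move=> du v0 x y xy.
have [|c _] := @MVT_segment _ u v x y (ltW xy) (fun z _ => du z).
- by apply: derivable_within_continuous => z _; have [] := du z.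
- by move=> e; rewrite -subr_gt0 e mulr_gt0// subr_gt0.
Qed.

Lemma quasiperiodic u (T : R) (n : nat) t :
  (forall t, u (t + T) = u t + T) -> u (t + T *+ n) = u t + T *+ n.
Proof.
move=> uT; elim: n t => [|n IH] t; first by rewrite !addr0.
by rewrite mulrS addrA IH uT -addrA.
Qed.

(** An antiderivative of the speed [sigma] is strictly increasing and gains a fixed length over each
    period. Rescaling this length to [T] lets [l] and its inverse [e] descend to the same circle. *)
Lemma arc_length (sigma : R -> R) (T : R) :
  0 < T -> (forall t, sigma (t + T) = sigma t) ->
  (forall t, 0 < sigma t) -> (forall n t, diffn n sigma t) ->
  exists (l e : R -> R) (c : R),
    [/\ 0 < c, cancel l e, cancel e l & forall t, l (t + T) = l t + T] /\
    [/\ forall t, is_derive t (1 : R) l (c * sigma t),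
        forall x, is_derive x (1 : R) e (c * sigma (e x))^-1,
        forall n t, diffn n l t & forall n x, diffn n e x].
Proof.
move=> T0 sT s0 ds.
have cs : continuous sigma.
  by move=> t; apply: derivable_continuous; exact: diffn_derivable (ds 1 t).
have [F dF] := antiderivative cs.
have Fi := derive_pos_incr dF s0.
pose L := F T - F 0.
have L0 : 0 < L by rewrite subr_gt0; exact: Fi.
have FT t : F (t + T) = F t + L.
  (* The increment over a period has derivative sigma (t + T) - sigma t = 0. *)
  suff H : F (t + T) - F t = F (0 + T) - F 0.
    by move: H; rewrite add0r -/L => <-; rewrite [RHS]addrC subrK.
  apply: (@derive0_cst _ (fun t => F (t + T) - F t)) => {}t.
  have dFT : is_derive t (1 : R) (fun t => F (t + T)) (sigma t).
    rewrite -[sigma t]mulr1 -sT.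
    apply: (@is_derive1_comp _ F (fun t => t + T)).
    by rewrite -[X in is_derive _ _ _ X]addr0; apply: is_deriveD.
  by rewrite -[X in is_derive _ _ _ X](subrr (sigma t)); apply: is_deriveB.
pose c := T / L; have c0 : 0 < c by exact: divr_gt0.
pose l t := c * F t.
have dl t : is_derive t (1 : R) l (c * sigma t).
  exact: (@is_deriveZ _ _ _ F c).
have lT t : l (t + T) = l t + T.
  by rewrite /l FT mulrDr divfK// gt_eqF.
have li x y : x < y -> l x < l y by move=> /Fi; rewrite ltr_pM2l.
have cl : continuous l.
  by move=> t; apply: derivable_continuous; have [] := dl t.
have surj y : exists x, l x = y.
  (* Moving n periods to either side of 0 carries [l] past y, and the intermediate value theorem
     applies. *)
  pose n := Num.bound (`|y - l 0| / T).
  have : `|y - l 0| < T *+ n.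
    rewrite -mulr_natl -ltr_pdivrMr//; apply: archi_boundP.
    by rewrite divr_ge0// ltW.
  rewrite ltr_distl => /andP[y1 y2].
  have Tn : 0 <= T *+ n by rewrite mulrn_wge0// ltW.
  have e1 : l (T *+ n) = l 0 + T *+ n.
    by have := quasiperiodic n 0 lT; rewrite add0r.
  have e2 : l (- (T *+ n)) = l 0 - T *+ n.
    by have := quasiperiodic n (- (T *+ n)) lT; rewrite addNr => ->;
      rewrite addrK.
  have [|||x _ xy] := @IVT _ l (- (T *+ n)) (T *+ n) y.
  - by rewrite (@le_trans _ _ 0)// oppr_le0.
  - exact: continuous_subspaceT.
  - rewrite e1 e2 ge_min le_max (ltW y1) (ltW y2) orbT.
    by [].
  - by exists x.
have [e le] := choice surj.
have el : cancel l e.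
  move=> x; have [/li|/li|//] := ltgtP (e (l x)) x; by rewrite le ltxx.
have de x : is_derive x (1 : R) e (c * sigma (e x))^-1.
  rewrite -{1}[x]le; apply: is_derive_inverse.
  - by apply: filterE => z; rewrite el.
  - by apply: filterE => z; exact: cl.
  - by rewrite mulf_neq0// gt_eqF.
exists l, e, c; split; split=> //.
- move=> [//|n]; apply: (diffnS dl) => t.
  by apply: diffnM => //; exact: diffn_cst.
(* Bootstrap: e' = 1 / (c sigma(e)) is as smooth as [e] is already known to be, so [e] gains one
   order. *)
- elim=> [//|n IH]; apply: (diffnS de) => x.
  apply: diffnV; first by rewrite mulf_neq0// gt_eqF.
  apply: diffnM; first exact: diffn_cst.
  by apply: diffn_comp; [exact: IH|exact: ds].
Qed.

End ArcLength.

(** * Discrete subgroups of the line *)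

Section Subgroup.
Context {R : realType} (S : R -> Prop).
Hypothesis SB : forall x y, S x -> S y -> S (x - y).

Lemma subgroup_mulz x (n : int) : S x -> S (n%:~R * x).
Proof.
move=> Sx; have S0 : S 0 by rewrite -(subrr x); exact: SB.
have SN y : S y -> S (- y) by move=> Sy; rewrite -sub0r; exact: SB.
have SM (m : nat) : S (m%:R * x).
  elim: m => [|m IH]; first by rewrite mul0r.
  by rewrite -natr1 mulrDl mul1r -[X in _ + X]opprK; apply: SB => //; exact: SN.
by case: n => m; rewrite ?NegzE ?mulrNz ?mulNr; [|apply: SN]; exact: SM.
Qed.

Lemma discrete_subgroup (T eps : R) : 0 < T -> S T -> 0 < eps ->
  (forall x, S x -> 0 < x -> eps <= x) ->
  exists2 k : nat, (0 < k)%N &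
    S (T / k%:R) /\ forall x, S x -> exists n : int, x = n%:~R * (T / k%:R).
Proof.
move=> T0 ST e0 Se.
have fl0 x : 0 < x -> 0 <= x / eps by move=> x0; rewrite divr_ge0// ltW.
(* A positive element tau with minimal integer part of x / eps is the least one: a smaller positive
   element would have the same integer part, and the difference would be a positive element below
   eps. *)
pose Q (n : nat) := `[< exists x, [/\ S x, 0 < x & Num.truncn (x / eps) = n] >].
have exQ : exists n, Q n.
  by exists (Num.truncn (T / eps)); apply/asboolP; exists T.
case: (ex_minnP exQ) => n /asboolP[tau [St t0 tn]] nmin.
have tmin x : S x -> 0 < x -> tau <= x.
  move=> Sx x0; rewrite leNgt; apply/negP => xt.
  have nx : (n <= Num.truncn (x / eps))%N by apply: nmin; apply/asboolP;
    exists x.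
  have d0 : 0 < tau - x by rewrite subr_gt0.
  have := Se _ (SB St Sx) d0; apply/negP; rewrite -ltNge.
  have h1 : n%:R <= x / eps.
    have le1 : (Num.truncn (x / eps))%:R <= x / eps by rewrite truncn_le fl0.
    by rewrite (le_trans _ le1)// ler_nat.
  have h2 : tau / eps < n.+1%:R by rewrite -tn truncnS_gt.
  have : tau / eps < x / eps + 1 by rewrite (lt_le_trans h2)// -natr1 lerD2r.
  by rewrite -ltrBlDl -mulrBl ltr_pdivrMr// mul1r.
have Smul x : S x -> exists m : int, x = m%:~R * tau.
  (* Euclidean division by tau: the remainder lies in [S] and in [0, tau), so it is 0. *)
  move=> Sx; exists (Num.floor (x / tau)); apply/eqP; rewrite -subr_eq0.
  set r := x - _; have Sr : S r by apply: SB => //; exact: subgroup_mulz.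
  have r0 : 0 <= r by rewrite subr_ge0 -ler_pdivlMr// floor_le.
  have rt : r < tau.
    rewrite ltrBlDl -[X in _ + X]mul1r -mulrDl -ltr_pdivrMr//.
    by have := floorD1_gt (x / tau); rewrite intrD.
  rewrite eq_le r0 andbT leNgt; apply/negP => /(tmin _ Sr).
  by rewrite leNgt rt.
have [m Tm] := Smul T ST.
have m0 : 0 < m by rewrite -(ltr0z R) -(pmulr_lgt0 _ t0) -Tm.
case: m Tm m0 => [k|//] Tk k0.
have tauE : T / k%:R = tau.
  by rewrite Tk mulrAC divff ?mul1r// pnatr_eq0 -lt0n.
by exists k => //; rewrite tauE.
Qed.

End Subgroup.

(** * The circle as a quotient of the line *)

Section Circle.
Context {R : realType}.
Local Notation T := (2 * pi : R).

Lemma twopi_gt0 : 0 < T.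
Proof. by rewrite mulr_gt0// pi_gt0. Qed.

Lemma circleP (t u : R) : \pi_(circle R) t = \pi_(circle R) u <->
  exists n : int, t = u + n%:~R * T.
Proof. by split=> [/eqP/circle_eqP|/circle_eqP/eqP]. Qed.

Lemma circle_surj (s : circle R) : exists t, s = \pi_(circle R) t.
Proof. by exists (repr s); rewrite reprK. Qed.

Lemma circle_piDT t : \pi_(circle R) (t + T) = \pi_(circle R) t.
Proof. by apply/circleP; exists 1; rewrite mul1r. Qed.

Lemma lift_int (l : R -> R) (n : int) t : (forall t, l (t + T) = l t + T) ->
  l (t + n%:~R * T) = l t + n%:~R * T.
Proof.
move=> lT.
have lTn (m : nat) x : l (x + m%:R * T) = l x + m%:R * T.
  by rewrite mulr_natl quasiperiodic.
case: n => n; first exact: lTn.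
rewrite NegzE mulrNz mulNr.
by rewrite -[t in RHS](subrK (n.+1%:R * T)) lTn addrK.
Qed.

(** Distinct multiples of [T] are at least [T] apart, while continuity keeps nearby values closer
    than that. *)
Lemma near_int_cst (g : R -> R) (x : R) : {for x, continuous g} ->
  (\forall y \near x, exists n : int, g y = n%:~R * T) ->
  \forall y \near x, g y = g x.
Proof.
move=> cg gZ.
have [n gx] := nbhs_singleton gZ.
have gT : \forall y \near x, `|g x - g y| < T.
  exact: ((cvgrPdist_lt _ _).1 cg T twopi_gt0).
apply: filterS2 gZ gT => y [m gy] /=; rewrite gx gy -mulrBl normrM.
rewrite (gtr0_norm twopi_gt0) gtr_pMl ?twopi_gt0// -intrB -intr_norm ltrz1.
move=> nm; have : `|n - m| <= 0 by rewrite -ltzD1.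
by rewrite normr_le0 subr_eq0 => /eqP ->.
Qed.

End Circle.

(** * Constant-speed parameter of an immersed closed curve *)

Section ArcLengthParameter.
Context {R : realType}.
Local Notation T := (2 * pi : R).
Context {I : finType} (X : I -> circle R -> R).
Let Xt i t := X i (\pi_(circle R) t).
Hypothesis smX : forall i n t, diffn n (Xt i) t.
Hypothesis immX : forall t, exists i, derive1 (Xt i) t != 0.

(** Applies [arc_length] to the Euclidean speed of the curve [X], which is positive and periodic.
    The [q i] are the velocity components in the new parameter. *)
Lemma arc_length_param : exists l e : R -> R,
  [/\ cancel l e, cancel e l & forall t, l (t + T) = l t + T] /\
  [/\ forall n t, diffn n l t, forall n x, diffn n e x,
      forall x, exists2 a, is_derive x (1 : R) e a & a != 0 &
      exists q : I -> R -> R, exists2 c : R, c != 0 & forall x,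
        (forall i, is_derive x (1 : R) (fun y => Xt i (e y)) (q i x)) /\
        \sum_i q i x ^+ 2 = c].
Proof.
pose s2 t := \sum_i derive1 (Xt i) t ^+ 2.
have s20 t : 0 < s2 t by apply: sumsq_gt0; exact: immX.
pose s t := Num.sqrt (s2 t).
have XT i t : Xt i (t + T) = Xt i t by rewrite /Xt circle_piDT.
have dX i t : is_derive t (1 : R) (Xt i) (derive1 (Xt i) t).
  by rewrite derive1E; apply: derivableP; exact: diffn_derivable (smX i 1 t).
have XT' i t : derive1 (Xt i) (t + T) = derive1 (Xt i) t.
  have E : is_derive t (1 : R) (fun t => Xt i (t + T)) (derive1 (Xt i) (t + T)).
    rewrite -[derive1 _ _]mulr1.
    apply: (@is_derive1_comp _ (Xt i) (fun t => t + T)).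
    by rewrite -[X in is_derive _ _ _ X]addr0; apply: is_deriveD.
  have : (fun t => Xt i (t + T)) = Xt i by apply/funext => r; exact: XT.
  by move: E => [_ <-] ->; rewrite derive1E.
have smX' i n t : diffn n (derive1 (Xt i)) t by have [] := smX i n.+1 t.
have sT t : s (t + T) = s t.
  by rewrite /s /s2; congr Num.sqrt; apply: eq_bigr => i _; rewrite XT'.
have s0 t : 0 < s t by rewrite sqrtr_gt0.
have ds n t : diffn n s t.
  apply: diffn_sqrt => //; apply: diffn_sum => i.
  by under eq_fun do rewrite expr2; apply: diffnM.
have [l [e [c [[c0 el le lT] [dl de sl se]]]]] := arc_length twopi_gt0 sT s0 ds.
exists l, e; split=> //; split=> //.
  move=> x; exists (c * s (e x))^-1; first exact: de.
  by rewrite invr_eq0 mulf_neq0// gt_eqF.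
(* The chain rule with e' = 1 / (c s(e)) gives these velocities; their squares add up to s^2 / (c
   s)^2 = c^-2. *)
exists (fun i x => derive1 (Xt i) (e x) * (c * s (e x))^-1), (c ^- 2).
  by rewrite invr_eq0 expf_neq0// gt_eqF.
move=> x; split=> [i|]; first exact: (@is_derive1_comp _ (Xt i) e).
under eq_bigr do rewrite exprMn.
rewrite -mulr_suml -/(s2 (e x)) exprVn exprMn invfM mulrCA.
by rewrite sqr_sqrtr ?ltW// divff ?mulr1// gt_eqF.
Qed.

End ArcLengthParameter.

(** * Circle maps that preserve an immersed closed curve *)

Section Rigidity.
Context {R : realType}.
Local Notation T := (2 * pi : R).
Context {I : finType} (X : I -> circle R -> R).
Let Xt i t := X i (\pi_(circle R) t).
Hypothesis smX : forall i n t, diffn n (Xt i) t.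
Hypothesis immX : forall t, exists i, derive1 (Xt i) t != 0.

(** At constant speed a map preserving the curve has slope 1 or -1, and -1 is excluded. The bound
    [eps] keeps the periods of the curve away from 0, so that they form a discrete group. *)
Lemma circle_rigidity : exists l e : R -> R,
  [/\ cancel l e, cancel e l & forall t, l (t + T) = l t + T] /\
  [/\ forall n t, diffn n l t, forall n x, diffn n e x,
      forall x, exists2 a, is_derive x (1 : R) e a & a != 0,
      exists2 eps, 0 < eps & forall tau, 0 < tau ->
        (forall i x, Xt i (e (x + tau)) = Xt i (e x)) -> eps <= tau &
      forall psi : circle R -> circle R, smooth_circle_map psi ->
        (forall i s, X i (psi s) = X i s) ->
        exists c, forall x,
          psi (\pi_(circle R) (e x)) = \pi_(circle R) (e (x + c))].
Proof.
have [l [e [[el le lT] [sl se de [q [c c0 qP]]]]]] := arc_length_param smX immX.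
have dq i x : is_derive x (1 : R) (fun y =>
  Xt i (e y)) (q i x) by exact: (qP x).1.
have sq x : \sum_i q i x ^+ 2 = c by exact: (qP x).2.
have q0 x : exists i, q i x != 0.
  apply/existsP; rewrite -[X in is_true X]negbK negb_exists; apply/negP =>
    /forallP h.
  move/eqP: c0; apply; rewrite -(sq x) big1// => i _.
  by have /negPn/eqP -> := h i; rewrite expr0n.
have eT (x y : R) (n : int) : e x = e y + n%:~R * T -> x = y + n%:~R * T.
  by move=> h; rewrite -[LHS]le h lift_int ?le.
have eT1 x : e (x + T) = e x + T by apply: (can_inj el); rewrite lT !le.
exists l, e; split=> //; split=> //.
  (* Some coordinate has nonzero velocity at 0, so it does not return to its value at 0 within some
     radius; a period below that radius is impossible. *)
  have [i qi0] := q0 0.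
  have /nbhs_ballP[eps /= eps0 he] := local_uniq (dq i 0) qi0.
  exists eps => // tau t0 /(_ i 0); rewrite add0r => hq.
  rewrite leNgt; apply/negP => te.
  have tau0 : tau = 0.
    by apply: he hq; rewrite -ball_normE /ball_/= sub0r normrN gtr0_norm.
  by move: t0; rewrite tau0 ltxx.
move=> psi spsi Xpsi.
have loc (x0 : R) : exists2 sg : R, sg ^+ 2 = 1 & exists d, \forall x \near x0,
    psi (\pi_(circle R) (e x)) = \pi_(circle R) (e (sg * x + d)).
  have [v /smooth_atP sv pv] := spsi (e x0).
  have ce x : {for x, continuous e} :=
    derivable_continuous (diffn_derivable (se 1%N x)).
  pose u x := l (v (e x)).
  have su : \forall x \near x0, forall n, diffn n u x.
    have := near_comp (@ce x0) sv; apply: filterS => x h n.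
    by apply: (@diffn_comp _ n l (fun x => v (e x))) => //; apply: diffn_comp.
  have pu : \forall x \near x0, psi (\pi_(circle R) (e x)) = \pi_(circle R) (e
    (u x)).
    by have := near_comp (@ce x0) pv; apply: filterS => x ->; rewrite /u el.
  have du : \forall x \near x0, is_derive x (1 : R) u (derive1 u x).
    apply: filterS su => x h; rewrite derive1E; apply: derivableP.
    exact: diffn_derivable (h 1%N).
  (* X \o psi = X and e has constant speed with respect to X. *)
  have u2 : \forall x \near x0, derive1 u x ^+ 2 = 1.
    apply: filterS2 (near_near pu) du => x px dux.
    have E i : q i x = q i (u x) * derive1 u x.
      have d1 : is_derive x (1 : R) (fun y =>
        Xt i (e (u y))) (q i (u x) * derive1 u x).
        exact: (@is_derive1_comp _ (fun y => Xt i (e y)) u).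
      have d2 : is_derive x (1 : R) (fun y => Xt i (e (u y))) (q i x).
        apply: near_eq_is_derive (dq i x).
        by apply: filterS px => y py; rewrite /Xt -py Xpsi.
      by case: d1 d2 => _ <- [_ <-].
    have := sq x; under eq_bigr do rewrite E exprMn.
    by rewrite -mulr_suml sq => /(canRL (mulKf c0)) ->; rewrite mulVf.
  have cu' : {for x0, continuous (derive1 u)}.
    apply: derivable_continuous.
    by have [_ [/nbhs_singleton]] := nbhs_singleton su 2%N.
  pose sg := derive1 u x0.
  have sg2 : sg ^+ 2 = 1 := nbhs_singleton u2.
  (* A continuous function with values in {1, -1} is locally constant, since its two possible values
     are 2 apart. *)
  have usg : \forall x \near x0, derive1 u x = sg.
    have n1 : \forall x \near x0, `|sg - derive1 u x| < 1.
      exact: ((cvgrPdist_lt _ _).1 cu' 1 ltr01).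
    apply: filterS2 n1 u2 => x n1 /eqP; rewrite -sg2 eqf_sqr =>
      /orP[/eqP //|/eqP E].
    move: n1; rewrite E opprK -mulr2n normrMn.
    have /eqP : `|sg| ^+ 2 = 1 by rewrite -normrX sg2 normr1.
    rewrite sqrf_eq1 => /orP[/eqP ->|/eqP h]; first by rewrite ltrn1.
    by have := normr_ge0 sg; rewrite h lerNr oppr0 ler10.
  exists sg => //; exists (u x0 - sg * x0).
  have ud : \forall x \near x0, is_derive x (1 : R) (fun x =>
    u x - (sg * x + 0)) 0.
    apply: filterS2 du usg => x dux E.
    have := is_deriveB dux (is_derive_affine sg 0 x).
    by rewrite E subrr.
  apply: filterS2 pu (near_derive0_cst ud) => x ->; rewrite !addr0 => <-.
  by rewrite addrC subrK.
have [sg sg2 [d nd]] := loc 0.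
(* The formula is asked on a neighbourhood, which makes its validity an open condition; the local
   normal form [loc] shows that its failure is open too. *)
have psiE : forall x : R, \forall y \near x,
    psi (\pi_(circle R) (e y)) = \pi_(circle R) (e (sg * y + d)).
  apply: (@near_clopen R (fun x => \forall y \near x,
    psi (\pi_(circle R) (e y)) = \pi_(circle R) (e (sg * y + d))) 0 _ _ nd)
    => [t|t nPt]; first exact: near_near.
  have [sg1 _ [d1 nd1]] := loc t.
  apply: filterS (near_near nd1) => x nd1x ndx.
  (* Where both formulas hold, their affine difference takes only multiples of [T], hence is
     constant: the slopes agree and the offsets agree on the circle. *)
  pose g (y : R) := (sg - sg1) * y + (d - d1).
  have dg (y : R) : is_derive y (1 : R) g (sg - sg1).
    exact: is_derive_affine.
  have gZ : \forall y \near x, exists n : int, g y = n%:~R * T.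
    apply: filterS2 ndx nd1x => y -> /circleP[n /eT E]; exists n.
    by rewrite /g mulrBl; lra.
  have cg : {for x, continuous g} by apply: derivable_continuous; have [] :=
    dg x.
  have gc := near_int_cst cg gZ.
  have sgE : sg = sg1.
    apply/eqP; rewrite -subr_eq0; apply/eqP.
    have : is_derive x (1 : R) g 0.
      apply: near_eq_is_derive (is_derive_cst (g x) x 1).
      by apply: filterS gc => y ->.
    by have [_ <-] := dg x; case=> _ <-.
  have [n gx] := nbhs_singleton gZ.
  apply: nPt; apply: filterS nd1 => y ->.
  apply/circleP; exists (- n).
  have -> : sg1 * y + d1 = (sg * y + d) + (- n)%:~R * T.
    by rewrite mulrNz mulNr -gx /g sgE; ring.
  exact: lift_int.
have psiE' x := nbhs_singleton (psiE x).
move/eqP: sg2; rewrite sqrf_eq1 => /orP[] /eqP sgE; rewrite sgE in psiE'.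
  by exists d => x; rewrite psiE' mul1r.
(* The reflection x |-> d - x fixes d / 2, where all velocities would vanish. *)
exfalso; have [i] := q0 (d / 2); move/eqP; apply.
have E y : Xt i (e y) = Xt i (e (d - y)).
  by have := Xpsi i (\pi_(circle R) (e y));
    rewrite psiE' mulN1r (addrC (- y)) => /esym.
have d1 : is_derive (d / 2) (1 : R) (fun y =>
  Xt i (e (d - y))) (q i (d / 2) * -1).
  have -> : q i (d / 2) = q i (d - d / 2) by congr (q i _); lra.
  apply: (@is_derive1_comp _ (fun y => Xt i (e y)) (fun y => d - y)).
  under eq_fun do rewrite addrC -mulN1r; exact: is_derive_affine.
have : q i (d / 2) = q i (d / 2) * -1.
  case: d1 => _ <-; case: (dq i (d / 2)) => _ <-.
  by congr (derive _ _ _); apply/funext.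
by lra.
Qed.

End Rigidity.

(** * Fronts and their duals *)

Section ProjectiveCoordinates.
Context {R : realType} {m : nat}.
Implicit Types (v w : 'rV[R]_m) (a : R -> 'rV[R]_m) (t : R).

Definition sqnorm v : R := \sum_k v 0 k ^+ 2.

(** For nonzero [v], the entries of the orthogonal projector onto the line spanned by [v] (the
    Veronese embedding), which do not depend on the chosen generator. *)
Definition proj_coord v (i j : 'I_m) : R := v 0 i * v 0 j / sqnorm v.

Lemma sqnorm_gt0 v : v != 0 -> 0 < sqnorm v.
Proof.
move=> v0; apply: sumsq_gt0; apply/existsP; apply: contraR v0.
rewrite negb_exists => /forallP h; apply/eqP/rowP => i.
by rewrite mxE; apply/eqP/negPn.
Qed.

Lemma proj_coordZ c v i j :
  c != 0 -> proj_coord (c *: v) i j = proj_coord v i j.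
Proof.
move=> c0; rewrite /proj_coord /sqnorm.
under eq_bigr do rewrite mxE exprMn.
rewrite -mulr_sumr !mxE invfM mulrACA (mulrC (c * v 0 i)) mulrA -!mulrA.
have [->|s0] := eqVneq (\sum_k v 0 k ^+ 2) 0; first by rewrite invr0 !mulr0.
by field; rewrite s0.
Qed.

Lemma is_derive_coord a t i : derivable a t 1 -> is_derive t (1 : R) (fun s =>
  a s 0 i) (derive1 a t 0 i).
Proof.
move=> da; have /derivable_mxP/(_ 0 i) dai := da.
by rewrite derive1E derive_mx// mxE; exact: derivableP.
Qed.

Lemma diffn_sqnorm n a t : diffn n a t -> diffn n (fun s => sqnorm (a s)) t.
Proof.
move=> /diffn_row da; apply: diffn_sum => k.
by under eq_fun do rewrite expr2; apply: diffnM.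
Qed.

Lemma diffn_proj_coord n a t i j : a t != 0 -> diffn n a t ->
  diffn n (fun s => proj_coord (a s) i j) t.
Proof.
move=> a0 da; have /diffn_row dai := da; apply: diffnM; first exact: diffnM.
apply: diffnV; last exact: diffn_sqnorm.
by rewrite gt_eqF// sqnorm_gt0.
Qed.

(** Differentiates [proj_coord] times [sqnorm] = a_i a_j, valid near t because [a] stays nonzero
    there. *)
Lemma proj_coord_derive a t i j p n : derivable a t 1 -> a t != 0 ->
    is_derive t (1 : R) (fun s => proj_coord (a s) i j) p ->
    is_derive t (1 : R) (fun s => sqnorm (a s)) n ->
  p * sqnorm (a t) + proj_coord (a t) i j * n =
  derive1 a t 0 i * a t 0 j + a t 0 i * derive1 a t 0 j.
Proof.
move=> da a0 dp dn.
have di := is_derive_coord i da; have dj := is_derive_coord j da.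
have d1 := is_deriveM di dj.
have d2 := is_deriveM dp dn.
have ca k : {for t, continuous (fun s => a s 0 k)}.
  by apply: derivable_continuous; have [] := is_derive_coord k da.
have nz : \forall s \near t, sqnorm (a s) != 0.
  have cn : {for t, continuous (fun s => sqnorm (a s))}.
    by apply: derivable_continuous; have [] := dn.
  by apply: (cvgr_neq0 _ cn); rewrite gt_eqF// sqnorm_gt0.
have E : \forall s \near t,
    ((fun s => proj_coord (a s) i j) \* (fun s => sqnorm (a s))) s =
    ((fun s => a s 0 i) \* (fun s => a s 0 j)) s.
  by apply: filterS nz => s s0; rewrite /= /proj_coord divfK.
have := near_eq_is_derive E d2.
have [_ e1] := d1; case=> _; rewrite e1 => e2.
have {}e2 : a t 0 i * derive1 a t 0 j + a t 0 j * derive1 a t 0 i =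
  proj_coord (a t) i j * n + sqnorm (a t) * p := e2.
by lra.
Qed.

Lemma is_derive_bigsum (h : 'I_m -> R -> R) (dh : 'I_m -> R) t :
  (forall i, is_derive t (1 : R) (h i) (dh i)) ->
  is_derive t (1 : R) (fun s => \sum_i h i s) (\sum_i dh i).
Proof.
move=> hd; have -> : (fun s => \sum_i h i s) = \sum_i h i.
  by apply/funext => s; rewrite fct_sumE.
exact: is_derive_sum.
Qed.

Lemma is_derive_sqnorm a t : derivable a t 1 ->
  is_derive t (1 : R) (fun s => sqnorm (a s))
    (2 * \sum_k a t 0 k * derive1 a t 0 k).
Proof.
move=> da; rewrite mulr_sumr; apply: is_derive_bigsum => k.
have dk := is_derive_coord k da.
have -> : (fun s => a s 0 k ^+ 2) = (fun s => a s 0 k) \* (fun s => a s 0 k).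
  by apply/funext => s; rewrite /= expr2.
by rewrite mulr_natl mulr2n; exact: is_deriveM.
Qed.

(** The projector coordinates immerse projective space: they lose only the radial part of a', which
    does not move the point. *)
Lemma proj_coord_derive0 a t : derivable a t 1 -> a t != 0 ->
  (forall i j, derivable (fun s => proj_coord (a s) i j) t 1) ->
  (forall i j, derive1 (fun s => proj_coord (a s) i j) t = 0) <->
  exists c, derive1 a t = c *: a t.
Proof.
move=> da a0 dpc; have N0 := sqnorm_gt0 a0.
have dn := is_derive_sqnorm da.
have dp i j : is_derive t (1 : R) (fun s => proj_coord (a s) i j)
   (derive1 (fun s => proj_coord (a s) i j) t).
  by rewrite derive1E; exact: derivableP.
have key i j := proj_coord_derive da a0 (dp i j) dn.
set S := \sum_k a t 0 k * derive1 a t 0 k in dn key *.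
split=> [p0|[c ac] i j].
  (* Multiplying [key] by a_j and summing over j gives 2 S a_i = a'_i |a|^2 + S a_i, which
     determines a'. *)
  exists ((2 * S - S) / sqnorm (a t)); apply/rowP => i; rewrite mxE.
  rewrite mulrAC; apply: (canRL (mulfK _)); first by rewrite gt_eqF.
  have : \sum_j (proj_coord (a t) i j * (2 * S)) * a t 0 j =
         \sum_j (derive1 a t 0 i * a t 0 j + a t 0 i * derive1 a t 0 j) * a t 0
           j.
    by apply: eq_bigr => j _; rewrite -key p0 mul0r add0r.
  have -> : \sum_j proj_coord (a t) i j * (2 * S) * a t 0 j = a t 0 i * (2 * S).
    rewrite [in RHS]mulrC -[a t 0 i in RHS](mulfK (lt0r_neq0 N0)) -mulrA.
    rewrite /sqnorm mulr_suml mulr_sumr.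
    rewrite [X in _ = X]mulr_sumr.
    by apply: eq_bigr => j _; rewrite /proj_coord; ring.
  have -> : \sum_j (derive1 a t 0 i * a t 0 j + a t 0 i * derive1 a t 0 j) * a
    t 0 j
     = derive1 a t 0 i * sqnorm (a t) + a t 0 i * S.
    rewrite /sqnorm /S !mulr_sumr -big_split/=.
    by apply: eq_bigr => j _; ring.
  by move=> e; rewrite mulrBl; lra.
have SE : S = c * sqnorm (a t).
  by rewrite /S mulr_sumr; apply: eq_bigr => k _; rewrite ac mxE; ring.
have := key i j; rewrite SE ac !mxE.
have -> : proj_coord (a t) i j * (2 * (c * sqnorm (a t))) = 2 * c * (a t 0 i *
  a t 0 j).
  rewrite /proj_coord -[X in _ = _ * X](mulfVK (lt0r_neq0 N0)).
  by ring.
move=> e; apply: (mulIf (lt0r_neq0 N0)); lra.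
Qed.

End ProjectiveCoordinates.

(** * Contact elements and bilinear forms *)

Section LinearAlgebra.
Context {R : realType}.
Implicit Types (f : 'Hom(V3 R, dualV3 R)) (v w : V3 R).

Lemma contact_elementP (K : fieldType) (W : vectType K) (c c' :
  contact_element W) :
  ce_point c = ce_point c' -> ce_line c = ce_line c' -> c = c'.
Proof.
case: c c' => [p l h] [p' l' h'] /= pp ll; rewrite {}pp {}ll in h *.
by congr ContactElement; exact: bool_irrelevance.
Qed.

Lemma limg_inj (K : fieldType) (W W' : vectType K) (f : 'Hom(W, W')) (U U' :
  {vspace W}) :
  injective f -> (f @: U = f @: U')%VS -> U = U'.
Proof.
by move=> /lker0P k0 /eqP; rewrite eq_limg_ker0// => /eqP.
Qed.

Lemma dim_lker_form (eta : dualV3 R) : eta != 0 -> \dim (lker eta) = 2%N.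
Proof.
move=> eta0; have := limg_ker_dim eta fullv.
rewrite capfv dimvf /dim /=.
have : (\dim (limg eta) <= 1)%N by have := dimvS (subvf (limg eta));
  rewrite dimvf.
have : (0 < \dim (limg eta))%N.
  rewrite lt0n dimv_eq0; apply: contra eta0 => /eqP h.
  apply/eqP/lfunP => v; rewrite zero_lfunE; apply/eqP.
  by rewrite -memv0 -h memv_img ?memvf.
by case: (\dim (limg eta)) => [|[|]]// _ _; rewrite addn1 => -[].
Qed.

Lemma form_sum f v w :
  f v w = \sum_i \sum_j v 0 i * w 0 j * f (delta_mx 0 i) (delta_mx 0 j).
Proof.
rewrite {1}(row_sum_delta v) linear_sum sum_lfunE; apply: eq_bigr => i _.
rewrite linearZ scale_lfunE {1}(row_sum_delta w) linear_sum scaler_sumr.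
by apply: eq_bigr => j _; rewrite linearZ scalerA.
Qed.

Lemma is_derive_form f (a b : R -> V3 R) (t : R) :
  derivable a t 1 -> derivable b t 1 ->
  is_derive t (1 : R) (fun s => f (a s) (b s) : R)
    (f (derive1 a t) (b t) + f (a t) (derive1 b t)).
Proof.
move=> da db; under eq_fun do rewrite form_sum.
rewrite !form_sum -big_split /=; apply: is_derive_bigsum => i.
rewrite -big_split /=; apply: is_derive_bigsum => j.
have di := is_derive_coord i da; have dj := is_derive_coord j db.
have := is_deriveM (is_deriveM di dj)
  (is_derive_cst (f (delta_mx 0 i) (delta_mx 0 j) : R) t 1).
set X := (X in is_derive _ _ _ X -> _) => h.
have <- : X = derive1 a t 0 i * b t 0 j * f (delta_mx 0 i) (delta_mx 0 j) +
              a t 0 i * derive1 b t 0 j * f (delta_mx 0 i) (delta_mx 0 j).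
  by rewrite /X scaler0 add0r /GRing.scale /=; ring.
exact: h.
Qed.

End LinearAlgebra.

(** * Smooth coordinates on a self-dual front *)

Section FrontCoordinates.
Context {R : realType} (G : front R) (phi : circle R -> circle R)
  (f : 'Hom(V3 R, dualV3 R)).
Hypothesis imm : immersed_legendrian G.
Hypothesis sd : self_duality G phi f.

Local Notation A s := (ce_point (G s)).
Local Notation B s := (ce_line (G s)).
Local Notation "'pr' t" := (\pi_(circle R) t) (at level 10, t at level 9).

Lemma duality_inj : injective f.
Proof. by case: sd => _ /bij_inj. Qed.

Lemma duality_neq0 v : v != 0 -> f v != 0.
Proof. by apply: contra => /eqP fv;
  rewrite -(inj_eq duality_inj) fv linear0. Qed.

Lemma dual_point s : (f @: A (phi s))%VS = annihilator (B s).
Proof. by case: sd => _ _ /(_ s)[]. Qed.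

Lemma dual_line s : (f @: B (phi s))%VS = annihilator (A s).
Proof. by case: sd => _ _ /(_ s)[]. Qed.

Lemma dim_point s : \dim (A s) = 1%N.
Proof. by have /and3P[/eqP] := ce_axiom (G s). Qed.

Lemma dim_line s : \dim (B s) = 2%N.
Proof. by have /and3P[_ /eqP] := ce_axiom (G s). Qed.

Lemma point_sub_line s : (A s <= B s)%VS.
Proof. by have /and3P[] := ce_axiom (G s). Qed.

Lemma point_gen_neq0 s a : A s = <[a]>%VS -> a != 0.
Proof. by move=> As; have := dim_point s; rewrite As dim_vline;
  case: (a == 0). Qed.

(** The covector [f al] is nonzero and annihilates B(s), so its kernel contains B(s) and has the
    same dimension 2. *)
Lemma line_form s al w : A (phi s) = <[al]>%VS -> (w \in B s) = (f al w == 0).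
Proof.
move=> As; have fal0 := duality_neq0 (point_gen_neq0 As).
have fann : f al \in annihilator (B s).
  by rewrite -dual_point As memv_img ?memv_line.
suff -> : B s = lker (f al) by rewrite memv_ker.
apply/eqP; rewrite eqEdim dim_lker_form// dim_line leqnn andbT.
by apply/subvP => v vB; rewrite memv_ker; apply/eqP;
  apply: (memv_annihilator _ _ fann).
Qed.

(* Coordinates of the pair (A(s), A(phi s)).  By duality A(phi s) carries the
   same information as B(s), and it has the same kind of coordinates as A(s). *)
Definition front_coord (k : bool * ('I_3 * 'I_3)) (s : circle R) : R :=
  proj_coord (vpick (A (if k.1 then s else phi s))) k.2.1 k.2.2.

Lemma proj_coord_gen s a i j : A s = <[a]>%VS ->
  proj_coord (vpick (A s)) i j = proj_coord a i j.
Proof.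
move=> As; have : vpick (A s) \in <[a]>%VS by rewrite -As memv_pick.
move=> /vlineP[c E]; rewrite E proj_coordZ//.
apply/eqP => c0; have := dim_point s.
have : vpick (A s) == 0 by rewrite E c0 scale0r.
by rewrite vpick0 => /eqP ->; rewrite dimv0.
Qed.

(** Half of the coordinates involve phi, but A(phi s) is recovered from B(s) through the injective
    [f]. *)
Lemma front_coord_eq s s' k : G s = G s' -> front_coord k s = front_coord k s'.
Proof.
move=> GE; rewrite /front_coord; case: k.1; first by rewrite GE.
suff -> : A (phi s) = A (phi s') by [].
by apply: (limg_inj duality_inj); rewrite !dual_point GE.
Qed.

(** Composes a frame of the front near [u t0] with a smooth local lift [u] of phi. *)
Lemma dual_frame (t0 : R) : exists al : R -> V3 R, smooth_at al t0 /\
  \forall t \near t0, A (phi (pr t)) = <[al t]>%VS.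
Proof.
have [[sphi _] _ _] := sd.
have [u /smooth_atP su pu] := sphi t0.
have [a [b [[/smooth_atP sa _ fr] _ _]]] := imm (u t0).
have cu : {for t0, continuous u}.
  exact: derivable_continuous (diffn_derivable (nbhs_singleton su 1%N)).
exists (fun t => a (u t)).
split.
  apply/smooth_atP; have sau := near_comp cu sa.
  apply: filterS2 su sau => t sut saut n; apply/diffn_row => j.
  apply: (@diffn_comp _ n (fun s => a s 0 j) u) => //.
  by move: j; apply/diffn_row.
have fru := near_comp cu fr.
by apply: filterS2 pu fru => t -> [].
Qed.

Lemma smooth_point_coord (a : R -> V3 R) t0 i j : smooth_at a t0 -> a t0 != 0 ->
  forall n, diffn n (fun t => proj_coord (a t) i j) t0.
Proof.
move=> /smooth_atP sa a0 n; apply: diffn_proj_coord => //.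
exact: (nbhs_singleton sa n).
Qed.

Lemma front_coord_frame (t0 : R) : exists a al : R -> V3 R,
  [/\ smooth_at a t0, smooth_at al t0,
    \forall t \near t0, A (pr t) = <[a t]>%VS /\ A (phi (pr t)) = <[al t]>%VS &
    forall k, \forall t \near t0,
      proj_coord (if k.1 then a t else al t) k.2.1 k.2.2 = front_coord k (pr
        t)].
Proof.
have [al [sal fal]] := dual_frame t0.
have [a [b [[sa _ fr] _ _]]] := imm t0.
exists a, al; split=> //.
  by apply: filterS2 fal fr => t ? [].
move=> [[] [i j]] /=; rewrite /front_coord/=.
  by apply: filterS fr => t [h _]; rewrite (proj_coord_gen _ _ h).
by apply: filterS fal => t h; rewrite (proj_coord_gen _ _ h).
Qed.

Lemma smooth_front_coord k n (t : R) : diffn n (fun t =>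
  front_coord k (pr t)) t.
Proof.
have [a [al [sa sal fr ck]]] := front_coord_frame t.
have [ha hal] := nbhs_singleton fr.
apply: diffn_eq (ck k) _; case: k.1.
  by apply: smooth_point_coord => //; exact: point_gen_neq0 ha.
by apply: smooth_point_coord => //; exact: point_gen_neq0 hal.
Qed.

Lemma smooth_at_derivable (E : normedModType R) (a : R -> E) (t : R) :
  smooth_at a t -> derivable a t 1.
Proof. by move=> sa; exact: (nbhs_singleton sa 0%N). Qed.

(** The parameters [b] and [c] treat the point A(s) and its partner A(phi s) at once. *)
Lemma frame_derive0 (b : bool) (c : circle R -> circle R) (a : R -> V3 R) (t0 :
  R) :
  (forall s, c s = if b then s else phi s) ->
  smooth_at a t0 -> (\forall t \near t0, A (c (pr t)) = <[a t]>%VS) ->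
  (forall i j, derive1 (fun t => front_coord (b, (i, j)) (pr t)) t0 = 0) <->
  exists r, derive1 a t0 = r *: a t0.
Proof.
move=> cE sa fr; have a0 := point_gen_neq0 (nbhs_singleton fr).
have E i j : \forall t \near t0,
    front_coord (b, (i, j)) (pr t) = proj_coord (a t) i j.
  apply: filterS fr => t h.
  by rewrite /front_coord/= -cE (proj_coord_gen _ _ h).
have E' i j := nbhs_singleton (near_eq_derive1 (E i j)).
have D i j : derivable (fun s => proj_coord (a s) i j) t0 1.
  exact: diffn_derivable (smooth_point_coord i j sa a0 1%N).
have [H1 H2] := proj_coord_derive0 (smooth_at_derivable sa) a0 D.
split=> [h|/H2 h i j]; last by rewrite E' h.
by apply: H1 => i j; rewrite -E' h.
Qed.

End FrontCoordinates.

Lemma is_derive_lfun (R : realType) (eta : dualV3 R) (a : R -> V3 R) (t : R) :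
  derivable a t 1 ->
  is_derive t (1 : R) (fun s => eta (a s) : R) (eta (derive1 a t)).
Proof.
have etaE v : eta v = \sum_i v 0 i * eta (delta_mx 0 i).
  rewrite {1}(row_sum_delta v) linear_sum.
  by apply: eq_bigr => i _; rewrite linearZ.
move=> da; under eq_fun do rewrite etaE.
rewrite etaE; apply: is_derive_bigsum => i.
have := is_deriveM (is_derive_coord i da)
  (is_derive_cst (eta (delta_mx 0 i) : R) t 1).
set Y := (X in is_derive _ _ _ X -> _) => h.
have <- : Y = derive1 a t 0 i * eta (delta_mx 0 i).
  by rewrite /Y scaler0 add0r /GRing.scale /= mulrC.
exact: h.
Qed.

(** * Velocities of the point and of its tangent line *)

Section Velocities.
Context {R : realType} (G : front R) (phi : circle R -> circle R)
  (f : 'Hom(V3 R, dualV3 R)).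
Hypothesis imm : immersed_legendrian G.
Hypothesis sd : self_duality G phi f.

Local Notation A s := (ce_point (G s)).
Local Notation B s := (ce_line (G s)).
Local Notation "'pr' t" := (\pi_(circle R) t) (at level 10, t at level 9).
Local Notation X k := (fun t => front_coord G phi k (pr t)).

(** If A and A(phi) both stand still, then a' lies in A, and differentiating F(al, b) = 0 with al'
    radial puts b' in B, against the immersion condition. *)
Lemma front_immersed (t0 : R) : exists k, derive1 (X k) t0 != 0.
Proof.
apply: contrapT => /forallNP X0.
have {}X0 k : derive1 (X k) t0 = 0 by have /negP/negPn/eqP := X0 k.
have [a [b [[sa sb fr] _ nab]]] := imm t0.
have [al [sal fal]] := dual_frame imm sd t0.
have fra : \forall t \near t0, A (pr t) = <[a t]>%VS by apply: filterS fr =>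
  t [].
have [r1 ar] := (frame_derive0 (b := true) (c := id) (fun=> erefl) sa fra).1
  (fun i j => X0 (true, (i, j))).
have [r2 alr] := (frame_derive0 (b := false) (c := phi) (fun=> erefl) sal fal).1
  (fun i j => X0 (false, (i, j))).
apply: nab; split.
  by rewrite (nbhs_singleton fra) ar memvZ ?memv_line.
rewrite (line_form sd _ (nbhs_singleton fal)).
have z : \forall t \near t0, f (al t) (b t) = 0.
  apply: filterS2 fr fal => t [_ Bt] At; apply/eqP;
    rewrite -(line_form sd _ At) Bt.
  by rewrite memv_span// !inE eqxx orbT.
have [_ d1] := is_derive_form f (smooth_at_derivable sal) (smooth_at_derivable
  sb).
have := @near_eq_derive R R R _ (fun=> 0) t0 (1 : R) z;
  rewrite d1 derive_cst alr linearZ scale_lfunE.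
by rewrite (nbhs_singleton z) scaler0 add0r => ->.
Qed.

(** Both a and a' lie in the fixed plane [lker eta] and, by the Legendrian condition, in B; as a' is
    not radial, they span each of the two. *)
Lemma locally_planar (t0 : R) (eta : dualV3 R) : eta != 0 ->
  (\forall t \near t0, (A (pr t) <= lker eta)%VS) ->
  (exists i j, derive1 (X (true, (i, j))) t0 != 0) -> B (pr t0) = lker eta.
Proof.
move=> eta0; set Y := lker eta => AY [i [j X0]].
have dY : \dim Y = 2%N := dim_lker_form eta0.
have [a [b [[sa sb fr] aB _]]] := imm t0.
have fra : \forall t \near t0, A (pr t) = <[a t]>%VS by apply: filterS fr =>
  t [].
have [_ H] := frame_derive0 (phi := phi) (b := true) (c :=
  id) (fun=> erefl) sa fra.
have na : ~ exists r, derive1 a t0 = r *: a t0.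
  by move=> /H/(_ i j) /eqP; rewrite (negPf X0).
have a'Y : derive1 a t0 \in Y.
  rewrite memv_ker.
  have z : \forall t \near t0, (eta (a t) : R) = 0.
    apply: filterS2 AY fra => t /subvP AYt At; apply/eqP.
    by rewrite -memv_ker AYt// At memv_line.
  have [_ <-] := is_derive_lfun eta (smooth_at_derivable sa).
  by rewrite (@near_eq_derive R R R _ (fun=> 0) t0 (1 : R) z) derive_cst.
have aY : a t0 \in Y.
  by rewrite (subvP (nbhs_singleton AY))// (nbhs_singleton fra) memv_line.
have aB0 : a t0 \in B (pr t0).
  by rewrite (subvP (point_sub_line G (pr t0)))// (nbhs_singleton fra)
    memv_line.
have a0 := point_gen_neq0 (nbhs_singleton fra).
have fr2 : free [:: derive1 a t0; a t0].
  rewrite free_cons span_seq1 seq1_free a0 andbT; apply/negP => /vlineP[r E].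
  by apply: na; exists r.
have gen (U : {vspace V3 R}) :
  \dim U = 2%N -> derive1 a t0 \in U -> a t0 \in U ->
    U = <<[:: derive1 a t0; a t0]>>%VS.
  move=> dU a'U aU; apply/esym/eqP; rewrite eqEdim dU.
  move: fr2; rewrite /free => /eqP ->; rewrite leqnn andbT.
  by apply/span_subvP => x; rewrite !inE => /orP[] /eqP ->.
by rewrite (gen _ (dim_line G _) aB aB0) -(gen Y).
Qed.

End Velocities.

(** * The cosquare of the form *)

Section FormMatrix.
Context {R : realType} (f : 'Hom(V3 R, dualV3 R)).
Hypothesis fi : injective f.

Definition form_mx : 'M[R]_3 := \matrix_(i, j) f (delta_mx 0 i) (delta_mx 0 j).

Lemma mul_form_mx (v : V3 R) j : (v *m form_mx) 0 j = f v (delta_mx 0 j).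
Proof.
rewrite mxE {2}(row_sum_delta v) linear_sum sum_lfunE.
by apply: eq_bigr => i _; rewrite mxE linearZ scale_lfunE.
Qed.

Lemma mul_tr_form_mx (v : V3 R) j : (v *m form_mx^T) 0 j = f (delta_mx 0 j) v.
Proof.
rewrite mxE {2}(row_sum_delta v) linear_sum.
by apply: eq_bigr => i _; rewrite !mxE linearZ.
Qed.

Lemma form_mx_unit : form_mx \in unitmx.
Proof.
rewrite -row_free_unit -kermx_eq0; apply/rowV0P => v /sub_kermxP vM.
apply/eqP; rewrite -(inj_eq fi) linear0; apply/eqP/lfunP => w.
rewrite zero_lfunE (row_sum_delta w) linear_sum big1// => j _.
rewrite linearZ; have := mul_form_mx v j; rewrite vM mxE => e.
by rewrite /= -e scaler0.
Qed.

Lemma form_sym_mx : form_mx^T = form_mx -> forall v w, f v w = f w v.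
Proof.
move=> sM v w; rewrite (form_sum f v) (form_sum f w) exchange_big/=.
apply: eq_bigr => i _; apply: eq_bigr => j _.
have /matrixP/(_ i j) := sM; rewrite !mxE => ->.
by rewrite (mulrC (v 0 j)).
Qed.

Lemma proportional_form (eta : dualV3 R) (th : V3 R -> R) :
  linear th -> eta != 0 ->
  (forall w, eta w = 0 -> th w = 0) -> exists r : R, forall w, th w = r * eta w.
Proof.
move=> lin eta0 h.
have [w0 ew0] : exists w0, eta w0 != 0.
  apply: contrapT => /forallNP n; move/eqP: eta0; apply; apply/lfunP => w.
  by rewrite zero_lfunE; apply/eqP/negPn/negP => k; exact: (n w).
exists (th w0 / eta w0) => w.
(* Projects w onto the kernel of eta along w0. *)
have e0 : eta (- (eta w / eta w0) *: w0 + w) = 0.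
  rewrite linearP; change (- (eta w / eta w0) * eta w0 + eta w = 0 :> R).
  by rewrite mulNr divfK// addNr.
have e1 : - (eta w / eta w0) * th w0 + th w = 0.
  by have := h _ e0; rewrite lin.
move: e1 => /eqP; rewrite addrC mulNr subr_eq0 => /eqP ->.
ring.
Qed.

(** Odd dimension enters here: determinants give r^3 = 1, transposing twice gives r^2 = 1. *)
Lemma scalar_cosquare (r : R) : form_mx^T = r *: form_mx -> form_mx^T = form_mx.
Proof.
move=> E; have Mu := form_mx_unit.
have d0 : \det form_mx != 0 by rewrite -unitfE -unitmxE.
have r3 : r ^+ 3 = 1.
  by apply: (mulIf d0); rewrite -detZ -E det_tr mul1r.
have r2 : r ^+ 2 = 1.
  have : form_mx = r ^+ 2 *: form_mx.
    by rewrite -{1}[form_mx]trmxK E linearZ /= E scalerA expr2.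
  move=> e; have : (r ^+ 2 - 1) *: form_mx = 0 by rewrite scalerBl scale1r -e
    subrr.
  move/eqP; rewrite scaler_eq0 subr_eq0 => /orP[/eqP //|/eqP M0].
  by move: d0; rewrite M0 det0 eqxx.
by rewrite E; move: r3; rewrite exprS r2 mulr1 => ->; rewrite scale1r.
Qed.

(** Eigenvalues are isolated: the characteristic polynomial is a power of X - lam t0 times a factor
    that stays nonzero at lam t for t near t0. *)
Lemma eigenvalue_loc_cst n (K : 'M[R]_n) (lam : R -> R) (t0 : R) :
  {for t0, continuous lam} -> (forall t, eigenvalue K (lam t)) ->
  \forall t \near t0, lam t = lam t0.
Proof.
move=> cl ev.
have [m [q q0 pE]] := multiplicity_XsubC (char_poly K) (lam t0).
have p0 : char_poly K != 0 by rewrite monic_neq0// char_poly_monic.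
rewrite p0/= in q0.
have cq : {for t0, continuous (fun t => q.[lam t])}.
  by apply: continuous_comp => //; exact: continuous_horner.
have nq : \forall t \near t0, q.[lam t] != 0 by exact: (cvgr_neq0 _ cq).
apply: filterS nq => t qt.
have := ev t; rewrite eigenvalue_root_char pE rootM /root (negPf qt)/=.
by rewrite horner_exp expf_eq0 hornerXsubC subr_eq0 => /andP[_ /eqP].
Qed.

End FormMatrix.

(** * An involutive phi forces a symmetric form *)

Section Involution.
Context {R : realType} (G : front R) (phi : circle R -> circle R)
  (f : 'Hom(V3 R, dualV3 R)).
Hypothesis imm : immersed_legendrian G.
Hypothesis sd : self_duality G phi f.

Local Notation A s := (ce_point (G s)).
Local Notation B s := (ce_line (G s)).
Local Notation "'pr' t" := (\pi_(circle R) t) (at level 10, t at level 9).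
Local Notation X k := (fun t => front_coord G phi k (pr t)).

(** With [b] true it is A that moves at t; with [b] false it is A(phi), equivalently the line B. *)
Definition moves (b : bool) (t : R) := exists ij, derive1 (X (b, ij)) t != 0.

Lemma near_moves b (t : R) : moves b t -> \forall s \near t, moves b s.
Proof.
move=> [ij h]; have [_ [/nbhs_singleton dX _]] :=
  smooth_front_coord imm sd (b, ij) 2 t.
have cX : {for t, continuous (derive1 (X (b, ij)))} := derivable_continuous dX.
have nX : \forall s \near t, derive1 (X (b, ij)) s != 0 by exact: (cvgr_neq0 _
  cX h).
by apply: filterS nX => s hs; exists ij.
Qed.

Lemma immobile_cst b : (forall t, ~ moves b t) ->
  forall ij s s', front_coord G phi (b, ij) s = front_coord G phi (b, ij) s'.
Proof.
move=> nm ij s s'; have [t ->] := circle_surj s; have [t' ->] := circle_surj s'.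
have d t0 : is_derive t0 (1 : R) (X (b, ij)) 0.
  have -> : 0 = derive1 (X (b, ij)) t0.
    by apply/esym/eqP/negPn/negP => h; apply: (nm t0); exists ij.
  rewrite derive1E; apply: derivableP.
  exact: diffn_derivable (smooth_front_coord imm sd (b, ij) 1 t0).
by rewrite (derive0_cst d t) (derive0_cst d t').
Qed.

Lemma cst_immobile b (t : R) : (forall ij, \forall s \near t,
    front_coord G phi (b, ij) (pr s) = front_coord G phi (b, ij) (pr t)) ->
  ~ moves b t.
Proof.
move=> c [ij]; apply/negP/negPn; rewrite derive1E.
rewrite (@near_eq_derive R R R _ (fun=> front_coord G phi (b, ij) (pr t)) t (1
  : R) (c ij)).
by rewrite derive_cst.
Qed.

(** Otherwise the sets where A moves and where A(phi) moves are disjoint, open and cover the line,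
    so one of them is empty. Then A or A(phi) is constant, hence both are because phi is onto, and
    nothing moves. *)
Lemma point_and_line_move : exists t, moves true t /\ moves false t.
Proof.
have [[_ [phi' [_ _ phiK]]] _ _] := sd.
apply: contrapT => /forallNP nm.
have some t : moves true t \/ moves false t.
  by have [[[] ij] h] := front_immersed imm sd t; [left|right]; exists ij.
have all b : moves b 0 -> forall t, moves b t.
  apply: near_clopen => [t|t nb]; first exact: near_moves.
  have mb : moves (~~ b) t by case: b nb => nb; case: (some t).
  apply: filterS (near_moves mb) => s ms1 ms2; apply: (nm s).
  by case: b {nb mb} ms1 ms2.
have tf ij s : front_coord G phi (false, ij) s = front_coord G phi (true, ij)
  (phi s) by [].
have [/all m|/all m] := some 0.
  have nf t : ~ moves false t by move=> mf; apply: (nm t).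
  apply: (@cst_immobile true 0) (m 0) => ij; apply: filterE => s.
  by rewrite -[pr s]phiK -[pr 0]phiK -!tf; exact: immobile_cst.
have nt t : ~ moves true t by move=> mf; apply: (nm t).
apply: (@cst_immobile false 0) (m 0) => ij; apply: filterE => s.
by rewrite !tf; exact: immobile_cst.
Qed.

Hypothesis phi2 : forall s, phi (phi s) = s.

(** The kernel of F(a, .) is B(phi s) since phi^2 = id, and F(., a) vanishes on B(phi s) by the dual
    of A(s). *)
Lemma point_eigen s a : A s = <[a]>%VS -> exists r :
  R, forall w, f w a = r * f a w.
Proof.
move=> As; have a0 := point_gen_neq0 As.
have As' : A (phi (phi s)) = <[a]>%VS by rewrite phi2.
apply: (@proportional_form R (f a) (fun w => f w a)).
- by move=> r v w; rewrite linearP /= add_lfunE scale_lfunE.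
- exact: (duality_neq0 sd).
move=> w /eqP; rewrite -(line_form sd _ As') => wB.
have : f w \in annihilator (A s) by rewrite -(dual_line sd) memv_img.
by move/memv_annihilator; apply; rewrite As memv_line.
Qed.

Local Notation M := (form_mx f).

Lemma involution_sym v w : f v w = f w v.
Proof.
have fi := duality_inj sd; have Mu := form_mx_unit fi.
pose K := M^T *m invmx M.
(* The eigenvalue written as the Rayleigh quotient of K at A(t); in projector coordinates its
   continuity in t is visible. *)
pose lam t := \sum_i \sum_j front_coord G phi (true, (i, j)) (pr t) * K i j.
have lamP t a : A (pr t) = <[a]>%VS -> a *m K = lam t *: a.
  move=> At; have [r ra] := point_eigen At.
  have aK : a *m K = r *: a.
    rewrite mulmxA; apply: (canLR (mulmxK Mu)).
    by apply/rowP => j; rewrite mul_tr_form_mx -scalemxAl mxE mul_form_mx ra.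
  rewrite aK; congr (_ *: _).
  have N0 := sqnorm_gt0 (point_gen_neq0 At).
  apply: (mulIf (lt0r_neq0 N0)).
  rewrite /lam mulr_suml.
  transitivity (\sum_j (a *m K) 0 j * a 0 j).
    by rewrite aK /sqnorm mulr_sumr; apply: eq_bigr => j _; rewrite mxE; ring.
  under eq_bigr do rewrite mxE mulr_suml.
  rewrite exchange_big /=; apply: eq_bigr => i _.
  rewrite mulr_suml; apply: eq_bigr => j _.
  rewrite /front_coord /= (proj_coord_gen _ _ At) /proj_coord.
  by field; rewrite gt_eqF.
have gen t : exists2 a, A (pr t) = <[a]>%VS & a != 0.
  have [a [b [[_ _ fr] _ _]]] := imm t; have [At _] := nbhs_singleton fr.
  by exists (a t) => //; exact: point_gen_neq0 At.
have clam t : {for t, continuous lam}.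
  apply: derivable_continuous; apply: (@diffn_derivable _ _ 0%N).
  apply: diffn_sum => i; apply: diffn_sum => j.
  by apply: diffnM; [exact: (smooth_front_coord imm sd)|exact: diffn_cst].
have ev t : eigenvalue K (lam t).
  by have [a At a0] := gen t; apply/eigenvalueP; exists a => //; exact: lamP.
have [t0 [mt mf]] := point_and_line_move.
have lc := eigenvalue_loc_cst (@clam t0) ev.
(* A nonzero column j of K - lam would give a fixed line eta containing A. *)
have KE : K = (lam t0)%:M.
  apply: contrapT => /eqP; rewrite -subr_eq0 => N0.
  have [i [j Nij]] : exists i j, (K - (lam t0)%:M) i j != 0.
    apply: contrapT => /forallNP n; move/eqP: N0; apply; apply/matrixP => i j.
    by rewrite [RHS]mxE; apply/eqP/negPn/negP => h; apply: (n i); exists j.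
  set N := K - _ in Nij.
  pose th (v : V3 R) : R^o := (v *m N) 0 j.
  have lth : linear th by move=> r u1 u2; rewrite /th mulmxDl -scalemxAl !mxE.
  pose thL := GRing.isLinear.Build _ _ _ _ th lth.
  pose thl : {linear V3 R -> R^o} := HB.pack th thL.
  pose eta : dualV3 R := linfun thl.
  have eta0 : eta != 0.
    apply: contraNneq Nij => e0; have := lfunE thl (delta_mx 0 i).
    by rewrite -/eta e0 zero_lfunE /= /th -rowE mxE => <-.
  have Aeta : \forall t \near t0, (A (pr t) <= lker eta)%VS.
    apply: filterS lc => t lt; have [a At a0] := gen t.
    rewrite At -memvE memv_ker lfunE /= /th mulmxBr (lamP _ _ At) lt.
    by rewrite mul_mx_scalar subrr mxE.
  have Beta : \forall t \near t0, B (pr t) = lker eta.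
    apply: filterS2 (near_near Aeta) (near_moves mt) => t At [[i' j'] mij].
    by apply: (locally_planar imm eta0 At (phi := phi)); exists i', j'.
  (* B is constant near t0, so by duality A(phi) is constant there, against [mf]. *)
  have Bt0 := nbhs_singleton Beta.
  apply: (@cst_immobile false t0) mf => ij; apply: filterS Beta => t Bt.
  rewrite /front_coord/=.
  suff -> : A (phi (pr t)) = A (phi (pr t0)) by [].
  by apply: (limg_inj fi); rewrite !(dual_point sd) Bt Bt0.
apply: form_sym_mx; apply: (scalar_cosquare fi (r := lam t0)).
by rewrite -mul_scalar_mx -KE mulmxKV.
Qed.

End Involution.

(** * Fronts with a nontrivial period *)

Section Quotient.
Context {R : realType}.
Local Notation T := (2 * pi : R).
Local Notation "'pr' t" := (\pi_(circle R) t) (at level 10, t at level 9).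

Lemma smooth_at_comp_row m (a : R -> 'rV[R]_m) (h : R -> R) (t : R) :
  (forall n s, diffn n h s) -> smooth_at a (h t) -> smooth_at (fun s =>
    a (h s)) t.
Proof.
move=> sh /smooth_atP sa; apply/smooth_atP.
have ch : {for t, continuous h} :=
  derivable_continuous (diffn_derivable (sh 1%N t)).
apply: filterS (near_comp ch sa) => s sas n; apply/diffn_row => j.
by apply: (@diffn_comp _ n (fun s => a s 0 j) h) => //; move: j;
  apply/diffn_row.
Qed.

Lemma derive1_comp_row m (a : R -> 'rV[R]_m) (h : R -> R) (t r : R) :
  derivable a (h t) 1 -> is_derive t (1 : R) h r ->
  derive1 (fun s => a (h s)) t = r *: derive1 a (h t).
Proof.
move=> da dh.
have dj j : is_derive t (1 : R) (fun s =>
  a (h s) 0 j) (derive1 a (h t) 0 j * r).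
  apply: (@is_derive1_comp _ (fun s => a s 0 j) h); exact: is_derive_coord.
have dah : derivable (fun s => a (h s)) t 1.
  by apply/derivable_mxP => i j; rewrite (ord1 i); have [] := dj j.
apply/rowP => j; rewrite mxE mulrC.
have [_ <-] := dj j; have [_ <-] := is_derive_coord j dah.
by [].
Qed.

Lemma smooth_circle_map_comp (phi psi : circle R -> circle R) :
  smooth_circle_map phi -> smooth_circle_map psi ->
  smooth_circle_map (fun s => phi (psi s)).
Proof.
move=> sphi spsi t0; have [u /smooth_atP su pu] := spsi t0.
have [v /smooth_atP sv pv] := sphi (u t0).
have cu : {for t0, continuous u}.
  exact: derivable_continuous (diffn_derivable (nbhs_singleton su 1%N)).
exists (fun t => v (u t)).
  apply/smooth_atP; apply: filterS2 su (near_comp cu sv) => t sut svt n.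
  exact: diffn_comp.
by apply: filterS2 pu (near_comp cu pv) => t -> ->.
Qed.

Variables (G : front R) (l e : R -> R) (k : nat).
Hypotheses (le : cancel l e) (el : cancel e l).
Hypothesis (lT : forall t, l (t + T) = l t + T).
Hypotheses (sl : forall n t, diffn n l t) (se : forall n x, diffn n e x).
Hypothesis de : forall x, exists2 a, is_derive x (1 : R) e a & a != 0.
Hypothesis k1 : (1 < k)%N.
Hypothesis Gk : forall x (n : int),
  G (pr (e (x + n%:~R * (T / k%:R)))) = G (pr (e x)).
Hypothesis imm : immersed_legendrian G.

Let k0 : k%:R != 0 :> R.
Proof. by rewrite pnatr_eq0 -lt0n ltnW. Qed.

(** The choice of representative is immaterial once [h] commutes with the shift by [T]. *)
Definition circle_lift (h : R -> R) (s : circle R) : circle R :=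
  pr (h (repr s)).

Lemma circle_repr t : exists n : int, repr (pr t) = t + n%:~R * T.
Proof. by apply/circleP; rewrite reprK. Qed.

Lemma circle_liftE (h : R -> R) t : (forall t, h (t + T) = h t + T) ->
  circle_lift h (pr t) = pr (h t).
Proof.
move=> hT; rewrite /circle_lift; have [n ->] := circle_repr t.
by apply/circleP; exists n; rewrite lift_int.
Qed.

Lemma smooth_circle_lift (h : R -> R) : (forall t, h (t + T) = h t + T) ->
  (forall n t, diffn n h t) -> smooth_circle_map (circle_lift h).
Proof.
move=> hT sh t0; exists h.
  by apply/smooth_atP; apply: filterE => t n; exact: sh.
by apply: filterE => t; exact: circle_liftE.
Qed.

Lemma inv_quasiperiodic x : e (x + T) = e x + T.
Proof. by apply: (can_inj le); rewrite lT !el. Qed.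

Lemma circle_lift_diffeo : circle_diffeo (circle_lift l).
Proof.
split; first exact: smooth_circle_lift.
exists (circle_lift e); split.
- exact: (smooth_circle_lift inv_quasiperiodic).
- move=> s; have [t ->] := circle_surj s.
  by rewrite circle_liftE// (circle_liftE _ inv_quasiperiodic) le.
- move=> s; have [t ->] := circle_surj s.
  by rewrite (circle_liftE _ inv_quasiperiodic) circle_liftE// el.
Qed.

(** One period T / k of the front, stretched over the whole circle; [Gk] makes the representative
    immaterial. *)
Definition quotient_front (s : circle R) := G (pr (e (repr s / k%:R))).

Lemma quotient_frontE x : quotient_front (pr x) = G (pr (e (x / k%:R))).
Proof.
rewrite /quotient_front; have [n ->] := circle_repr x.
by rewrite mulrDl -mulrA Gk.
Qed.

(** Pulling a frame back along x |-> e (x / k) multiplies both derivatives by one nonzero factor, so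
    the Legendrian and immersion conditions carry over. *)
Lemma quotient_front_immersed : immersed_legendrian quotient_front.
Proof.
move=> t0; pose h t := e (t / k%:R).
have sdiv n (t : R) : diffn n (fun t => t / k%:R) t.
  by apply: diffnM; [exact: diffn_id|exact: diffn_cst].
have sh n t : diffn n h t by apply: (@diffn_comp _ n e (fun t => t / k%:R)).
have [r dr r0] := de (t0 / k%:R).
have dh : is_derive t0 (1 : R) h (r * k%:R^-1).
  apply: (@is_derive1_comp _ e (fun t => t / k%:R)).
  have := is_derive_affine k%:R^-1 0 t0.
  by under eq_fun do rewrite addr0 mulrC.
have rk : r * k%:R^-1 != 0 by rewrite mulf_neq0// invr_eq0.
have ch : {for t0, continuous h} :=
  derivable_continuous (diffn_derivable (sh 1%N t0)).
have [a [b [[sa sb fr] aB nab]]] := imm (h t0).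
have da := derive1_comp_row (smooth_at_derivable sa) dh.
have db := derive1_comp_row (smooth_at_derivable sb) dh.
exists (fun t => a (h t)), (fun t => b (h t)); split.
- split; [exact: smooth_at_comp_row|exact: smooth_at_comp_row|].
  by apply: filterS (near_comp ch fr) => t; rewrite quotient_frontE.
- by rewrite quotient_frontE da memvZ.
- by rewrite quotient_frontE da db !rpredZeq (negPf rk).
Qed.

Lemma quotient_is_multiple : is_multiple G.
Proof.
(* The reparameterization is the passage to arc length; multiplication by k then cancels the
   division by k in [quotient_front]. *)
exists k, quotient_front, (circle_lift l); split=> //.
- exact: quotient_front_immersed.
- exact: circle_lift_diffeo.
move=> s; have [t ->] := circle_surj s.
by rewrite circle_liftE// circle_piMn quotient_frontE -[l t *+ k]mulr_natr
  mulfK// le.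
Qed.

End Quotient.

(** * A symmetric form forces an involutive phi *)

Section Symmetric.
Context {R : realType} (G : front R) (phi : circle R -> circle R)
  (f : 'Hom(V3 R, dualV3 R)).
Hypothesis imm : immersed_legendrian G.
Hypothesis sd : self_duality G phi f.
Hypothesis nmult : ~ is_multiple G.
Hypothesis fsym : forall v w, f v w = f w v.
Local Notation T := (2 * pi : R).

Local Notation A s := (ce_point (G s)).
Local Notation B s := (ce_line (G s)).
Local Notation "'pr' t" := (\pi_(circle R) t) (at level 10, t at level 9).

Lemma limg_dim_inj (U : {vspace V3 R}) : \dim (f @: U)%VS = \dim U.
Proof.
apply: limg_dim_eq; have /lker0P/eqP -> := duality_inj sd.
by rewrite capv0.
Qed.

(** Since f maps B(phi s) to the annihilator of A(s), symmetry puts f A(s) in the annihilator of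
    B(phi s), which is f A(phi^2 s); dimensions agree. Lines are treated alike. *)
Lemma front_phi2 s : G (phi (phi s)) = G s.
Proof.
apply/esym/contact_elementP; apply: (limg_inj (duality_inj sd)); apply/eqP;
  rewrite eqEdim.
  rewrite !limg_dim_inj !dim_point leqnn andbT (dual_point sd).
  apply/subvP => _ /memv_imgP[a aA ->]; apply/memv_annihilator => u uB.
  rewrite fsym; have :
    f u \in annihilator (A s) by rewrite -(dual_line sd) memv_img.
  by move/memv_annihilator; apply.
rewrite !limg_dim_inj !dim_line leqnn andbT (dual_line sd).
apply/subvP => _ /memv_imgP[b bB ->]; apply/memv_annihilator => u uA.
rewrite fsym; have :
  f u \in annihilator (B s) by rewrite -(dual_point sd) memv_img.
by move/memv_annihilator; apply.
Qed.

Lemma symmetric_involution s : phi (phi s) = s.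
Proof.
have [l [e [[le el lT] [sl se de [eps eps0 disc] rigid]]]] :=
  circle_rigidity (smooth_front_coord imm sd) (front_immersed imm sd).
have [[sphi _] _ _] := sd.
have [c psiE] := rigid _ (smooth_circle_map_comp sphi sphi)
  (fun k s => front_coord_eq sd k (front_phi2 s)).
(* The periods of the front in arc length: a subgroup containing [T] and the translation c realized
   by phi^2, with positive elements bounded below by [eps]. *)
pose S tau := forall x, G (pr (e (x + tau))) = G (pr (e x)).
have SB x y : S x -> S y -> S (x - y).
  move=> Sx Sy z; have -> : z + (x - y) = (z - y) + x by ring.
  by rewrite Sx -Sy subrK.
have eT x : e (x + T) = e x + T := inv_quasiperiodic le el lT x.
have ST : S T by move=> x; rewrite eT circle_piDT.
have Sc : S c by move=> x; rewrite -psiE front_phi2.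
have [k k0 [Sk Sgen]] := discrete_subgroup SB (twopi_gt0 (R := R)) ST eps0
  (fun x Sx x0 => disc x x0 (fun i y => front_coord_eq sd i (Sx y))).
have [k1|k1] := ltnP 1 k.
  exfalso; apply: nmult;
    apply: (quotient_is_multiple le el lT sl se de k1 _ imm).
  by move=> x n; apply: (subgroup_mulz SB n Sk).
have {k0 k1}k1 : k = 1%N by apply/eqP; rewrite eqn_leq k1 k0.
(* As k = 1, c is a multiple of 2 pi, and translation by it is the identity of the circle. *)
have [n cE] := Sgen c Sc; have [t ->] := circle_surj s.
have := psiE (l t); rewrite le => ->; rewrite cE k1 divr1 lift_int// le.
by apply/circleP; exists n.
Qed.

End Symmetric.

Theorem proposition16 (R : realType) (G : front R)
    (phi : circle R -> circle R) (f : 'Hom(V3 R, dualV3 R)) :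
  immersed_legendrian G ->
  self_duality G phi f ->
  ~ is_multiple G ->
  (forall s, phi (phi s) = s) <->
  (forall v w, assoc_form f v w = assoc_form f w v).
Proof.
move=> imm sd nmult; split=> [phi2 v w | fsym s].
  exact: (involution_sym imm sd phi2).
exact: (symmetric_involution imm sd nmult fsym).
Qed.
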